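(* An Abelian topological group $X$ is compact if and only if for any injective continuous homomorphism $f:X\to Y$ to a topological group $Y$ the image $f(X)$ is closed in $Y$.
   Context: All topological groups are assumed to be Hausdorff. *)

(* Defs.v *)
From HB Require Import structures.
From mathcomp Require Import all_boot all_order.
From mathcomp Require Import all_classical topology.

Set Implicit Arguments.
Unset Strict Implicit.
Unset Printing Implicit Defensive.

(* The group law is written multiplicatively, since the codomains under
   consideration need not be commutative: [TopologicalZmodule] only covers
   the Abelian case.  Separation is not part of the structure. *)
HB.mixin Record Group_isTopologicalGroup G & Topological G & Group G := {
  mulg_continuous : continuous (fun xy : G * G => (xy.1 * xy.2)%g);
  invg_continuous : continuous (fun x : G => (x^-1)%g)
}.

#[short(type="topologicalGroupType")]
HB.structure Definition TopologicalGroup :=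
  {G of Topological G & Group G & Group_isTopologicalGroup G}.

(* Main.v *)
From HB Require Import structures.
Require Import Defs.
From mathcomp Require Import all_boot all_order all_algebra.
From mathcomp Require Import all_classical all_reals topology normedtype Rstruct.
From mathcomp Require Import zify ring lra.

(** Why the theorem holds.  One direction is the compactness of continuous
    images.  For the other, write X additively.  A coarser Hausdorff group
    topology W on X and a W-Cauchy filter G without limit yield a continuous
    injection with non-closed image: adjoin to X a formal limit of G, that is,
    topologize X * int so that (x, -1) tends to 0 as x runs along G, and make
    the result Hausdorff ([closed_images_complete_below]).  Hence X is complete
    in all its coarser Hausdorff group topologies, in particular in its own, and
    it remains to show that X is precompact.

    Suppose that it is not.  A sequence y is constructed together with a coarser
    Hausdorff topology in which y is Cauchy along an ultrafilter but does not
    converge.  The neighbourhoods of this topology are the sets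
    {sum b_n y_n : sum b_n = 0, sum |b_n| w_n < 1} + V, where V is a
    neighbourhood of zero in X and w is a weight tending to 0 along the
    ultrafilter ([coarser_nbhs]).  That y is Cauchy is built in.  The rest needs
    y to be independent in a suitable sense.

    - If, for some neighbourhood U, no nonzero multiple c X were covered by
      finitely many translates of U, independence over int relative to U would
      do; but c X may be small, and then only the residues of the coefficients
      can be controlled.  A [level] is a pair (n, U) such that n X is covered by
      finitely many translates of U while c X is not, even for a larger set in
      place of U, whenever n does not divide c.  Every neighbourhood V has a
      level with n X covered by finitely many translates of V
      ([level_exists]).  A covering argument in the spirit of B. H. Neumann
      ([avoid_translates]) then gives a sequence such that for every level a
      combination of y lying in U has coefficients divisible by n, up to finitely
      many indices ([independent_sequence_dvd]).
    - Comparing two approximations of the same point, the second one with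
      weights that kill the support of the first, makes every coefficient of the
      second divisible by n ([approximable_dvd]).  For a limit of y the
      coefficients would sum to 1, which contradicts a level with n <> 1, and
      such a level exists because X is not precompact.
    - For a point x in all coarser neighbourhoods, the combination approximating
      x becomes n times a combination of the same kind.  The combinations c for
      which n c is small form a set finitely many translates of which cover the
      free group {poly int}.  By Foelner's theorem ([folner]) its double
      difference set contains a neighbourhood of zero for a totally bounded
      pseudonorm, and a totally bounded pseudonorm is dominated by a vanishing
      weight on the combinations of coefficient sum zero
      ([pseudonorm_le_weight]).  So the approximation is small, and x = 0
      ([approximable0]).

    Foelner's theorem is obtained without characters.  With an invariant mean M
    and a large box Z, the function t |-> avg_(x in Z) 1_A(x - u) 1_A(x + t) is
    an average of functions that depend on u only through a 0-1 factor, so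
    sampling a bounded number of the x shows that few of these functions are far
    apart ([overlap_dist_close]); their distance in the mean is, in the limit
    over Z, the required pseudonorm. *)

Set Implicit Arguments.
Unset Strict Implicit.
Unset Printing Implicit Defensive.

Import Order.TTheory GRing.Theory Num.Theory.
Import numFieldNormedType.Exports.
Local Open Scope classical_set_scope.
Local Open Scope quotient_scope.
Local Open Scope ring_scope.

(** * Neighbourhood filters of zero and their Hausdorff quotients *)

(** A group topology on an abelian group is handled through its filter of
    neighbourhoods of zero, so that several topologies on one carrier can be
    compared by inclusion of filters. *)
Record group_nbhs (Z : zmodType) (N : set_system Z) : Prop := {
  group_nbhs_filter : Filter N;
  group_nbhs0 : forall A, N A -> A 0;
  group_nbhsB : forall A, N A ->
    exists2 B, N B & forall x y, B x -> B y -> A (x - y)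
}.

Definition separated_nbhs (Z : zmodType) (N : set_system Z) :=
  forall x, (forall A, N A -> A x) -> x = 0.

Definition cauchy_for (Z : zmodType) (N G : set_system Z) :=
  forall A, N A -> exists2 P, G P & forall x y, P x -> P y -> A (x - y).

Definition converges_to (Z : zmodType) (N G : set_system Z) (x : Z) :=
  forall A, N A -> G [set u | A (u - x)].

Section SeparatedQuotient.
Variables (Z : zmodType) (N : set_system Z) (gN : group_nbhs N).

#[local] Instance gN_filter : Filter N := group_nbhs_filter gN.

Lemma group_nbhsN A : N A -> N [set x | A (- x)].
Proof.
move=> /(group_nbhsB gN)[B NB BA]; apply: filterS (NB) => x Bx /=.
by rewrite -sub0r; apply: BA => //; exact: (group_nbhs0 gN NB).
Qed.

Lemma group_nbhsD A : N A ->
  exists2 B, N B & forall x y, B x -> B y -> A (x + y).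
Proof.
move=> /(group_nbhsB gN)[B NB BA].
exists (B `&` [set x | B (- x)]); first exact: filterI (group_nbhsN NB).
by move=> x y [Bx _] [_ By]; rewrite -[y]opprK; exact: BA.
Qed.

Definition kernel : {pred Z} := fun x => `[< forall A, N A -> A x >].

Lemma kernel_zmod_closed : zmod_closed kernel.
Proof.
split; first by apply/asboolP => A NA; exact: (group_nbhs0 gN NA).
move=> x y /asboolP kx /asboolP ky; apply/asboolP => A /(group_nbhsB gN)[B NB].
by apply; [exact: kx|exact: ky].
Qed.

HB.instance Definition _ := GRing.isZmodClosed.Build Z kernel kernel_zmod_closed.

(** The quotient by the closure of zero, written multiplicatively since the
    target groups of the theorem are. *)
Definition sepquot := Algebra.to_multiplicative (Quotient.quot kernel).
HB.instance Definition _ := Choice.on sepquot.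
HB.instance Definition _ := Group.on sepquot.
Definition proj (x : Z) : sepquot := \pi_(Quotient.quot kernel) x.

Lemma projM x y : proj (x + y) = (proj x * proj y)%g.
Proof. exact: pi_addr. Qed.

Lemma projV x : proj (- x) = ((proj x)^-1)%g.
Proof. exact: pi_oppr. Qed.

Lemma proj_surj (q : sepquot) : exists x, proj x = q.
Proof. by exists (repr q); rewrite /proj reprK. Qed.

Lemma proj_eq x y : proj x = proj y <-> forall A, N A -> A (x - y).
Proof.
have E : (x - y \in kernel) = (\pi_(Quotient.quot kernel) x == \pi y) :=
  Quotient.idealrBE kernel x y.
split=> [h|h]; last by apply/eqP; rewrite -[_ == _]E; apply/asboolP.
by apply/asboolP; rewrite -[asbool _]/(x - y \in kernel) E; apply/eqP.
Qed.

Definition sepquot_nbhs (q : sepquot) : set_system sepquot :=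
  [set S | exists x, proj x = q /\
     exists2 A, N A & forall a, A a -> S (proj (x + a))].

Lemma sepquot_nbhsP x S : sepquot_nbhs (proj x) S <-> N [set a | S (proj (x + a))].
Proof.
split=> [[y [/proj_eq yx [A NA AS]]]|NS]; last first.
  by exists x; split=> //; exists [set a | S (proj (x + a))].
have [B NB BA] := group_nbhsD NA.
apply: filterS (NB) => b Bb /=.
suff -> : proj (x + b) = proj (y + b).
  by apply/AS; rewrite -[b]addr0; apply: BA => //; exact: (group_nbhs0 gN NB).
apply/esym/proj_eq => C NC; rewrite opprD addrACA subrr addr0; exact: yx.
Qed.

HB.instance Definition _ := hasNbhs.Build sepquot sepquot_nbhs.

Lemma sepquot_nbhs_filter (p : sepquot) : ProperFilter (nbhs p).
Proof.
have [x <-] := proj_surj p.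
apply: Build_ProperFilter_ex.
  move=> S /sepquot_nbhsP NS; exists (proj (x + 0)).
  exact: (group_nbhs0 gN NS).
split.
- by apply/sepquot_nbhsP; exact: filterT.
- move=> S T /sepquot_nbhsP NS /sepquot_nbhsP NT; apply/sepquot_nbhsP.
  exact: filterI NS NT.
- move=> S T ST /sepquot_nbhsP NS; apply/sepquot_nbhsP.
  by apply: filterS NS => a /ST.
Qed.

Lemma sepquot_nbhs_singleton (p : sepquot) (A : set sepquot) : nbhs p A -> A p.
Proof.
have [x <-] := proj_surj p => /sepquot_nbhsP /(group_nbhs0 gN) /=.
by rewrite addr0.
Qed.

Lemma sepquot_nbhs_nbhs (p : sepquot) (A : set sepquot) :
  nbhs p A -> nbhs p (nbhs^~ A).
Proof.
have [x <-] := proj_surj p => /sepquot_nbhsP NS; apply/sepquot_nbhsP.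
have [B NB BA] := group_nbhsD NS.
apply: filterS (NB) => a Ba /=; apply/sepquot_nbhsP; apply: filterS NB => b Bb /=.
by rewrite -addrA; exact: BA.
Qed.

HB.instance Definition _ := Nbhs_isNbhsTopological.Build sepquot
  sepquot_nbhs_filter sepquot_nbhs_singleton sepquot_nbhs_nbhs.

Lemma sepquot_mul_continuous : continuous (fun xy : sepquot * sepquot => (xy.1 * xy.2)%g).
Proof.
move=> [p q]; have [x <-] := proj_surj p; have [y <-] := proj_surj q => S /=.
rewrite -projM => /sepquot_nbhsP /group_nbhsD[B NB BS].
exists ([set proj (x + b) | b in B], [set proj (y + b) | b in B]) => /=.
  by split; apply/sepquot_nbhsP; apply: filterS (NB) => b Bb; exists b.
move=> [_ _] [/= [b Bb <-] [c Bc <-]] /=; rewrite -projM addrACA; exact: BS.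
Qed.

Lemma sepquot_inv_continuous : continuous (fun x : sepquot => (x^-1)%g).
Proof.
move=> p; have [x <-] := proj_surj p => S; rewrite -projV => /sepquot_nbhsP NS.
apply/sepquot_nbhsP; apply: filterS (group_nbhsN NS) => a /=.
by rewrite -opprD projV.
Qed.

HB.instance Definition _ := Group_isTopologicalGroup.Build sepquot
  sepquot_mul_continuous sepquot_inv_continuous.

Lemma sepquot_hausdorff : hausdorff_space sepquot.
Proof.
move=> p q; have [x <-] := proj_surj p; have [y <-] := proj_surj q => clpq.
apply/proj_eq => A NA; have [B NB BA] := group_nbhsD NA.
have [C NC CB] := group_nbhsB gN NB.
have nC z : nbhs (proj z) [set proj (z + c) | c in C].
  by apply/sepquot_nbhsP; apply: filterS NC => c Cc; exists c.
have [_ [[c Cc <-] [d Cd]]] := clpq _ _ (nC x) (nC y).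
move=> /esym/proj_eq/(_ _ NB) Bxy.
have -> : x - y = (x + c - (y + d)) + (d - c).
  by rewrite opprD [x + c + _]addrACA -!addrA addKr subrr addr0.
by apply: BA => //; exact: CB.
Qed.

End SeparatedQuotient.

(** Completeness in all coarser Hausdorff group topologies; this is the form in
    which the hypothesis on closed images is used. *)
Definition complete_below (Z : zmodType) (N : set_system Z) :=
  forall W : set_system Z, group_nbhs W -> W `<=` N -> separated_nbhs W ->
  forall G : set_system Z, ProperFilter G -> cauchy_for W G ->
  exists x, converges_to W G x.

Section AdjoinLimit.
Variables (Z : zmodType) (W G : set_system Z).
Hypotheses (gW : group_nbhs W) (GF : ProperFilter G).

(** The pair (x, k) stands for x + k g, where g is a formal limit of G: it is
    small when x + k u is small for G-almost all u. *)
Definition adjoin_nbhs : set_system (Z * int) :=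
  [set S | exists2 V, W V &
     [set p : Z * int | G [set u | V (p.1 + u *~ p.2)]] `<=` S].

Lemma adjoin_group_nbhs : group_nbhs adjoin_nbhs.
Proof.
have WF := group_nbhs_filter gW.
split.
- split.
  + by exists setT => //; exact: filterT.
  + move=> S T [V WV VS] [V' WV' VT]; exists (V `&` V'); first exact: filterI.
    move=> p /= Gp; split; [apply: VS|apply: VT];
      by apply: filterS Gp => u [].
  + by move=> S T ST [V WV VS]; exists V => // p /VS /ST.
- move=> S [V WV VS]; apply: VS => /=.
  by apply: filterE => u; change (V (0 + u *~ 0)); rewrite mulr0z addr0;
    exact: (group_nbhs0 gW WV).
- move=> S [V WV VS]; have [V' WV' V'V] := group_nbhsB gW WV.
  exists [set p : Z * int | G [set u | V' (p.1 + u *~ p.2)]].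
    by exists V'.
  move=> p q Gp Gq; apply: VS => /=.
  apply: filterS (filterI Gp Gq) => u [/= pu qu].
  change (V (p.1 - q.1 + u *~ (p.2 - q.2))).
  by rewrite mulrzBr addrACA -opprD; exact: V'V.
Qed.

(** This is what makes (0, 1) a limit of the points (x, 0). *)
Lemma cauchy_limit_adherent (S : set (Z * int)) : cauchy_for W G ->
  adjoin_nbhs S -> exists x, S (x, -1).
Proof.
move=> cG [V WV VS]; have [P GP PV] := cG _ WV.
have [x Px] := filter_ex GP; exists x; apply: VS => /=.
by apply: filterS GP => u Pu /=; rewrite mulrN1z; exact: PV.
Qed.

End AdjoinLimit.

Section AdditiveNotation.
Variables (X : topologicalGroupType).
Hypothesis X_abelian : commutative (fun x y : X => (x * y)%g).

(** An alias carries the additive structure, whose instance depends on the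
    proof of commutativity. *)
Definition additive_of (_ : commutative (fun x y : X => (x * y)%g)) : Type := X.
Let A := additive_of X_abelian.

HB.instance Definition _ := Choice.copy A X.
HB.instance Definition _ := GRing.isZmodule.Build A
  (@mulgA X) X_abelian (@mul1g X) (@mulVg X).

Definition nbhs_one : set_system A := @nbhs X X 1%g.

Lemma nbhs_one_group_nbhs : group_nbhs nbhs_one.
Proof.
split; first exact: (nbhs_filter (1%g : X)).
- by move=> S /nbhs_singleton.
- move=> S NS.
  have [|[P Q] /= [NP NQ] PQS] := @mulg_continuous X (1%g, 1%g) S.
    by rewrite /= mulg1.
  have NQ' : nbhs (1%g : X) [set x | Q (x^-1)%g].
    by apply: (@invg_continuous X 1%g Q); rewrite invg1.
  exists (P `&` [set x : X | Q (x^-1)%g]); first exact: filterI NQ'.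
  by move=> x y [Px _] [_ Qy]; exact: (PQS (x, y^-1)%g).
Qed.

Lemma nbhs_translate (x : X) (S : set X) :
  nbhs x S <-> nbhs_one [set u | S (x * u)%g].
Proof.
have tr (a b : X) (T : set X) : nbhs (a * b)%g T -> nbhs b [set u | T (a * u)%g].
  move=> /(@mulg_continuous X (a, b))[[P Q] /= [NP NQ] PQT].
  apply: filterS NQ => u Qu; apply: (PQT (a, u)); split => //=.
  exact: nbhs_singleton.
split=> [NS|NS]; first by apply: (tr x 1%g); rewrite mulg1.
have := tr (x^-1)%g x [set u | S (x * u)%g]; rewrite mulVg => /(_ NS).
by apply: filterS => u /=; rewrite mulgA mulgV mul1g.
Qed.

Lemma nbhs_one_separated : hausdorff_space X -> separated_nbhs nbhs_one.
Proof.
move=> hX x Nx; apply/esym/hX => S T NS /nbhs_translate NT.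
exists x; split; first exact: Nx.
by have := nbhs_singleton NT; rewrite /= mulg1.
Qed.

(** In the Hausdorff quotient Y of X * int, the image of X has (0, 1) in its
    closure.  As it is closed, (0, 1) agrees there with some (x, 0), which says
    that G converges to x.  The map to Y is injective because the topology
    induced on X is W, and W is Hausdorff. *)
Lemma closed_images_complete_below :
  (forall (Y : topologicalGroupType) (f : {multiplicative X -> Y}),
     hausdorff_space Y -> injective f -> continuous f -> closed (range f)) ->
  complete_below nbhs_one.
Proof.
move=> clX W gW WN sepW G GF cG.
pose gN := adjoin_group_nbhs gW GF.
pose f (x : X) : sepquot gN := proj gN (x : A, 0).
have fM : {morph f : x y / (x * y)%g}.
  by move=> x y; rewrite /f -projM; congr (proj _ (_, _)).
pose fm : {multiplicative X -> sepquot gN} :=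
  HB.pack f (isMultiplicative.Build X (sepquot gN) f fM).
have finj : injective fm.
  move=> x y /proj_eq fxy; apply/eqP; rewrite -(@subr_eq0 A); apply/eqP/sepW => V WV.
  have nV : adjoin_nbhs W G [set p | G [set u | V (p.1 + u *~ p.2)]].
    by exists V.
  have /filter_ex[u] := fxy _ nV.
  by rewrite /= subr0 mulr0z addr0.
have fcont : continuous fm.
  move=> x S /sepquot_nbhsP[V WV VS]; apply/nbhs_translate.
  apply: filterS (WN _ WV) => u Vu /=; rewrite fM; rewrite -projM; apply: VS => /=.
  by apply: filterE => v; change (V (u + v *~ 0)); rewrite mulr0z addr0.
have := clX _ fm (@sepquot_hausdorff _ _ gN) finj fcont.
move=> /(_ (proj gN (0, 1)))[].
  move=> S /sepquot_nbhsP /(cauchy_limit_adherent GF cG)[x Sx].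
  exists (fm x); split; first by exists x.
  suff E : (0, 1) + (x : A, - 1) = (x, 0) :> A * int by move: Sx; rewrite /= E.
  by congr (_, _); rewrite ?add0r ?subrr.
move=> x _ /esym/proj_eq fx; exists x => V WV.
have nV : adjoin_nbhs W G [set p | G [set u | V (p.1 + u *~ p.2)]].
  by exists V.
by have := fx _ nV; apply: filterS => u /=; rewrite subr0 mulr1z sub0r addrC.
Qed.

End AdditiveNotation.

(** * Finite coverings of multiples *)

Section Covering.
Variable Z : zmodType.
Implicit Types (A B U : set Z) (c d : int).

(** The group c Z lies in finitely many translates of A. *)
Definition covered A c :=
  exists F : seq Z, forall x, exists2 f, f \in F & A (x *~ c - f).

Definition diffset A : set Z := [set x - y | x in A & y in A].

Lemma diffsetP A x y : A x -> A y -> diffset A (x - y).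
Proof. by move=> Ax Ay; exists x => //; exists y. Qed.

Lemma covered_sub A B c : A `<=` B -> covered A c -> covered B c.
Proof.
move=> AB [F FA]; exists F => x; have [f fF Af] := FA x.
by exists f => //; exact: AB.
Qed.

Lemma covered0 A : A 0 -> covered A 0.
Proof. by move=> A0; exists [:: 0] => x; exists 0; rewrite ?mem_head ?mulr0z ?subrr. Qed.

Lemma covered_comb A B C c d s t : covered A c -> covered B d ->
  (forall x y, A x -> B y -> C (x + y)) -> covered C (s * c + t * d).
Proof.
move=> [F FA] [E EB] ABC; exists [seq f + e | f <- F, e <- E] => x.
have [f fF Af] := FA (x *~ s); have [e eE Be] := EB (x *~ t).
exists (f + e); first exact: allpairs_f.
by rewrite mulrzDr !mulrzA opprD addrACA; exact: ABC.
Qed.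

(** If c_j Z is not covered by translates of U_j - U_j, the set S of the z with
    c_j z in F_j + U_j is disjoint from its translate S - x0 for some x0.  So one
    of z and z + x0 avoids it, for each z, and the constraint j can be dropped if
    the remaining ones are imposed on both z and z + x0.  Only the finite sets F
    grow, which allows an induction. *)
Lemma avoid_translates (I : eqType) (s : seq I) (c : I -> int)
    (U : I -> set Z) (F : I -> seq Z) :
  (forall i, i \in s -> ~ covered (diffset (U i)) (c i)) ->
  exists x, forall i f, i \in s -> f \in F i -> ~ U i (x *~ c i - f).
Proof.
elim: s F => [|j s IH] F ncov; first by exists 0.
have /existsNP[x0 x0P] : ~ forall x, exists2 f,
    f \in [seq a - b | a <- F j, b <- F j] & diffset (U j) (x *~ c j - f).
  by move=> h; apply: (ncov j (mem_head _ _)); eexists; exact: h.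
have [|z zP] := IH (fun i => F i ++ [seq f - x0 *~ c i | f <- F i]).
  by move=> i si; apply: ncov; rewrite inE si orbT.
have [zj|] := pselect (forall f, f \in F j -> ~ U j (z *~ c j - f)).
  exists z => i f; rewrite inE => /predU1P[->|si fF]; first exact: zj.
  by apply: zP => //; rewrite mem_cat fF.
move=> /existsNP[f /not_implyP[fF /contrapT Uf]].
exists (z + x0) => i g; rewrite inE => /predU1P[-> gF Ug|si gF].
  apply: x0P; exists (g - f); first exact: allpairs_f.
  have -> : x0 *~ c j - (g - f) = ((z + x0) *~ c j - g) - (z *~ c j - f).
    rewrite mulrzDl !opprB [z *~ _ + _]addrC -!addrA; congr (_ + _).
    by rewrite addrC -!addrA addNr addr0 addrC.
  exact: diffsetP.
rewrite mulrzDl -addrA -[x0 *~ c i - g]opprB; apply: zP => //.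
by rewrite mem_cat (map_f (fun f => f - _)) ?orbT.
Qed.

(** The gap between U and its double difference set leaves room for the errors
    in the construction of independent sequences.  For n = 0 the first condition
    is trivial and the second says that no nonzero multiple is covered. *)
Definition level (n : nat) U :=
  covered U n /\
  forall c, ~~ (n%:Z %| c)%Z -> ~ covered (diffset (diffset U)) c.

(** Thickening by c Z works in the quotient by c Z, where only divisors of c
    matter. *)
Definition thicken A c : set Z := [set a + x *~ c | a in A & x in setT].

Lemma thicken_sub A B c : A `<=` B -> thicken A c `<=` thicken B c.
Proof. by move=> AB _ [a Aa [x _ <-]]; exists a; [exact: AB|exists x]. Qed.

Lemma sub_thicken A c : A `<=` thicken A c.
Proof. by move=> a Aa; exists a => //; exists 0; rewrite // mul0rz addr0. Qed.

Lemma diffset_thicken A c : diffset (thicken A c) `<=` thicken (diffset A) c.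
Proof.
move=> _ [_ [a Aa [x _ <-]]] [_ [b Ab [y _ <-]]] <-.
exists (a - b); first exact: diffsetP.
by exists (x - y); rewrite // mulrzBl opprD addrACA.
Qed.

Lemma covered_thicken A c : A 0 -> covered (thicken A c) c.
Proof.
move=> A0; exists [:: 0] => x; exists 0; rewrite ?mem_head// subr0.
by exists 0 => //; exists x; rewrite // add0r.
Qed.

Lemma coveredN A c : covered A (- c) -> covered A c.
Proof.
move=> [F FA]; exists F => x; have [f fF Af] := FA (- x); exists f => //.
by move: Af; rewrite mulNrz mulrNz opprK.
Qed.

Variables (N : set_system Z) (gN : group_nbhs N).
#[local] Instance N_filter : Filter N := group_nbhs_filter gN.

Lemma group_nbhs_diffset2 A : N A -> exists2 B, N B &
  forall x y, diffset (diffset B) x -> B y -> A (x + y).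
Proof.
move=> /(group_nbhsD gN)[A1 NA1 A1A]; have [A2 NA2 A2A1] := group_nbhsB gN NA1.
have [B NB BA2] := group_nbhsB gN NA2.
exists (A1 `&` B); first exact: filterI.
move=> _ y [_ [a [_ Ba] [b [_ Bb] <-]] [_ [c [_ Bc] [d [_ Bd] <-]] <-]] [A1y _].
by apply: A1A => //; apply: A2A1; exact: BA2.
Qed.

(** Either some U0 covers no nonzero multiple, and n = 0 will do; or every
    neighbourhood covers a nonzero multiple.  In the second case fix c with c Z
    covered by a small V1, and thicken all neighbourhoods by c Z: the least j > 0
    with j Z covered by the thickened W is at most c, and can only grow as W
    shrinks.  So it stabilizes, at some W, to a value n which is the same for all
    smaller neighbourhoods.  If a small W2 covered d Z up to double differences,
    then by Bezout W would cover gcd(d, n) Z, whence n divides d. *)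
Lemma level_exists V : N V ->
  exists n U, [/\ N U, level n U & covered V n].
Proof.
move=> NV.
have [[U0 NU0 U0P]|] :=
    pselect (exists2 U, N U & forall c, c != 0 -> ~ covered U c).
  have [U NU UU0] := group_nbhs_diffset2 NU0.
  exists 0%N, U; split=> //; last exact: covered0 (group_nbhs0 gN NV).
  split=> [|c]; first exact: covered0 (group_nbhs0 gN NU).
  rewrite dvd0z => c0 /covered_sub covU; apply: (U0P c c0); apply: covU => x Dx.
  by rewrite -[x]addr0; apply: UU0 => //; exact: (group_nbhs0 gN NU).
move=> /forall2NP noU.
have {}noU U : N U -> exists2 c : nat, (0 < c)%N & covered U c.
  move=> NU; have [//|/existsNP[c /not_implyP[c0 /contrapT covU]]] := noU U.
  exists `|c|%N; first by rewrite absz_gt0.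
  by case: c {c0} covU => [//|n]; rewrite NegzE; exact: coveredN.
have [V1 NV1 V1V] := group_nbhsD gN NV.
have [c c_gt0 covV1] := noU _ NV1.
(* Q n says that the least covered positive multiple can be made at least n. *)
pose Q n := exists W, [/\ N W, W `<=` V1 &
  forall j : nat, (0 < j < n)%N -> ~ covered (thicken W c) j].
have Q1 : Q 1%N.
  by exists V1; split=> // j; rewrite ltnS leqn0 => /andP[]; case: j.
have Qle n : `[< Q n >] -> (n <= c)%N.
  move=> /asboolP[W [NW _ WP]]; rewrite leqNgt; apply/negP => cn.
  by apply: (WP c); rewrite ?c_gt0//; exact: covered_thicken (group_nbhs0 gN NW).
have exQ : exists n, `[< Q n >] by exists 1%N; apply/asboolP.
have [n /asboolP[W [NW WV1 WP]] nmax] := ex_maxnP exQ Qle.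
have n_gt0 : (0 < n)%N by apply: nmax; apply/asboolP.
have covW W' : N W' -> W' `<=` W -> covered (thicken W' c) n.
  move=> NW' W'W; apply: contrapT => ncov.
  have /asboolP/nmax : Q n.+1; last by rewrite ltnn.
  exists W'; split=> //; first exact: subset_trans WV1.
  move=> j /andP[j0]; rewrite ltnS leq_eqVlt => /predU1P[->//|jn] /covered_sub.
  by move=> /(_ _ (thicken_sub W'W)); apply: WP; rewrite j0.
(* By maximality of n, passing to any smaller W2 does not increase the least
   covered multiple, which leaves room for double differences. *)
have [W2 NW2 W2W] := group_nbhs_diffset2 NW.
have W2sub : W2 `<=` W.
  move=> x W2x; rewrite -[x]add0r; apply: W2W => //.
  have W20 := group_nbhs0 gN NW2.
  by have := diffsetP (diffsetP W20 W20) (diffsetP W20 W20); rewrite !subr0.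
have covU : covered (thicken W2 c) n by exact: covW.
exists n, (thicken W2 c); split.
- by apply: filterS NW2; exact: sub_thicken.
- split=> // d nd covd.
  have [s [t stE]] := Bezoutz d n.
  have covg : covered (thicken W c) (gcdz d n).
    rewrite -stE; apply: covered_comb covd covU _ => x _ DDx [y W2y [z _ <-]].
    have [a DDa [b _ <-]] : thicken (diffset (diffset W2)) c x.
      apply: (diffset_thicken (A := diffset W2)).
      by case: DDx => u /diffset_thicken ? [v /diffset_thicken ? <-]; exact: diffsetP.
    exists (a + y); first exact: W2W.
    by exists (b + z); rewrite // mulrzDl addrACA.
  apply: (WP (gcdn `|d| n)); last exact: covg.
  rewrite gcdn_gt0 n_gt0 orbT /= ltn_neqAle dvdn_leq ?dvdn_gcdr// andbT.
  by apply: contra nd => /eqP gn; change (n %| `|d|)%N; rewrite -gn dvdn_gcdl.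
- have [F FU] := covU; have [E EV] := covV1.
  exists [seq f + e | f <- F, e <- E] => x.
  have [f fF [a W2a [y _ faE]]] := FU x; have [e eE V1e] := EV y.
  exists (f + e); first exact: allpairs_f.
  by rewrite opprD addrA -faE -addrA; apply: V1V => //; exact/WV1/W2sub.
Qed.

End Covering.

(** * Sequences independent at every level *)

Section Combination.
Variables (Z : zmodType) (y : nat -> Z).

(** Polynomials over int serve as the free abelian group on the terms of y. *)
Definition combination (b : {poly int}) := \sum_(i < size b) y i *~ b`_i.

Lemma combination_widen M (b : {poly int}) : (size b <= M)%N ->
  combination b = \sum_(i < M) y i *~ b`_i.
Proof.
move=> bM; rewrite /combination !(big_ord_widen _ (fun i => y i *~ b`_i) bM).
rewrite big_mkcond; apply: eq_bigr => i _; case: ltnP => // /(nth_default 0) ->.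
by rewrite mulr0z.
Qed.

Lemma combinationB : {morph combination : a b / a - b}.
Proof.
move=> a b; pose M := maxn (size a) (maxn (size b) (size (a - b))).
rewrite !(@combination_widen M) ?leq_max ?leqnn ?orbT// -sumrB.
by apply: eq_bigr => i _; rewrite coefB mulrzBr.
Qed.

Lemma combination0 : combination 0 = 0.
Proof. by rewrite /combination size_poly0 big_ord0. Qed.

Lemma combinationXn n : combination 'X^n = y n.
Proof.
rewrite /combination size_polyXn big_ord_recr /= coefXn eqxx mulr1z.
rewrite big1 ?add0r// => i _; rewrite coefXn ltn_eqF ?mulr0z//.
Qed.

Lemma combinationMz b (n : int) : combination (b *~ n) = combination b *~ n.
Proof.
pose M := maxn (size b) (size (b *~ n)).
rewrite !(@combination_widen M) ?leq_max ?leqnn ?orbT// mulrz_suml.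
by apply: eq_bigr => i _; rewrite coefMrz mulrzz mulrzA.
Qed.

Lemma finite_bounded_sums n : exists F : seq Z, forall b : nat -> int,
  (forall i, (`|b i| <= i)%N) -> \sum_(i < n) y i *~ b i \in F.
Proof.
elim: n => [|n [F FP]].
  by exists [:: 0] => b _; rewrite big_ord0 mem_head.
exists [seq f + y n *~ (i%:Z - n%:Z) | f <- F, i <- iota 0 n.*2.+1] => b bP.
rewrite big_ord_recr [X in X \in _]/=; have bn := bP n.
have -> : b n = (absz (b n + n%:Z))%:Z - n%:Z by lia.
apply: (allpairs_f (fun f i => f + y n *~ (i%:Z - n%:Z))); first exact: FP.
by rewrite mem_iota; lia.
Qed.

End Combination.

Section GenericSequence.
Variables (Z : zmodType) (lv : nat -> nat) (U : nat -> set Z).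
Hypothesis lvP : forall k, level (lv k) (U k).

(** The multiple z of lv k stands for the combinations of later terms whose
    coefficients are divisible by lv k; these are infinitely many, but lie in
    finitely many translates of U k.  Coefficients are bounded by their index to
    keep the rest of the constraint finite. *)
Definition independent_term (y : nat -> Z) n x :=
  forall k c, (k <= n)%N -> (`|c| <= n)%N -> ~~ ((lv k)%:Z %| c)%Z ->
  forall (b : nat -> int) z, (forall i, (`|b i| <= i)%N) ->
  ~ U k (x *~ c + \sum_(i < n) y i *~ b i + z *~ (lv k)%:Z).

Lemma independent_term_exists y n : exists x, independent_term y n x.
Proof.
have [G GP] := finite_bounded_sums y n.
have /choice[F FP] k : exists F : seq Z, forall x,
    exists2 f, f \in F & U k (x *~ (lv k)%:Z - f) by have [] := lvP k.
pose s := [seq i <- [seq (k, j%:Z - n%:Z) | k <- iota 0 n.+1, j <- iota 0 n.*2.+1]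
             | ~~ ((lv i.1)%:Z %| i.2)%Z].
have [|x xP] := @avoid_translates Z _ s snd (fun i => diffset (U i.1))
    (fun i => [seq - (g + f) | g <- G, f <- F i.1]).
  by move=> i; rewrite mem_filter => /andP[ndvd _]; have [_] := lvP i.1; apply.
exists x => k c kn cn ndvd b z bP Ux.
have [f fF Uf] := FP k z.
apply: (xP (k, c) (- (\sum_(i < n) y i *~ b i + f))).
- rewrite mem_filter; apply/andP; split=> //.
  have -> : c = (absz (c + n%:Z))%:Z - n%:Z by lia.
  by apply: (allpairs_f (fun k j => (k, j%:Z - n%:Z))); rewrite mem_iota; lia.
- by apply: (allpairs_f (fun g f => - (g + f))) => //; exact: GP.
- rewrite opprK /= (_ : _ + _ = (x *~ c + \sum_(i < n) y i *~ b i + z *~ (lv k)%:Z)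
    - (z *~ (lv k)%:Z - f)); first exact: diffsetP.
  by rewrite opprB [f - _]addrC [RHS]addrA addrK addrA.
Qed.

Lemma independent_sequence_exists : exists y, forall n, independent_term y n (y n).
Proof.
have /choice[step stepP] (p : seq Z) := independent_term_exists (nth 0 p) (size p).
pose f n := iter n (fun p => rcons p (step p)) [::].
have fS n : size (f n) = n by elim: n => //= n IH; rewrite size_rcons IH.
have nth_f n i : (i < n)%N -> nth 0 (f n) i = step (f i).
  elim: n => // n IH; rewrite ltnS leq_eqVlt /= nth_rcons fS.
  by move=> /predU1P[->|lt_in]; [rewrite ltnn eqxx|rewrite lt_in IH].
exists (step \o f) => n k c kn cn ndvd b z bP.
have := stepP (f n) k c; rewrite fS => /(_ kn cn ndvd b z bP).
suff -> : \sum_(i < n) nth 0 (f n) i *~ b i = \sum_(i < n) step (f i) *~ b i by [].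
by apply: eq_bigr => i _; rewrite nth_f.
Qed.

(** Look at the last index n >= k whose coefficient is not divisible by lv k:
    everything after it sums to a multiple of lv k, everything before it is a
    combination of earlier terms, so y n violates its independence. *)
Lemma independent_sequence_dvd y : (forall n, independent_term y n (y n)) ->
  forall k (b : {poly int}), (forall i, (`|(b`_i)%R| <= i)%N) ->
  U k (combination y b) -> forall n, (k <= n)%N -> ((lv k)%:Z %| b`_n)%Z.
Proof.
move=> yP k b bP Ub n0 kn0; apply/negPn/negP => ndvd0.
pose P n := (k <= n)%N && ~~ ((lv k)%:Z %| b`_n)%Z.
have P0 : P n0 by rewrite /P kn0.
have Pb n : P n -> (n <= size b)%N.
  move=> /andP[_]; rewrite leqNgt; apply: contra => /ltnW bn.
  by rewrite nth_default // dvdz0.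
have [n /andP[kn ndvd] nmax] := ex_maxnP (ex_intro P n0 P0) Pb.
have nb : (n < size b)%N.
  by rewrite ltnNge; apply: contra ndvd => bn; rewrite nth_default// dvdz0.
have [z zE] : exists z, \sum_(n.+1 <= i < size b) y i *~ b`_i = z *~ (lv k)%:Z.
  rewrite big_nat; elim/big_ind: _ => [|_ _ [u ->] [v ->]|i /andP[ni _]].
  - by exists 0; rewrite mul0rz.
  - by exists (u + v); rewrite mulrzDl.
  - have : ~~ P i by apply/negP => /nmax; rewrite leqNgt ni.
    rewrite /P (leq_trans kn (ltnW ni)) negbK => /dvdzP[q ->].
    by exists (y i *~ q); rewrite mulrzA.
apply: (yP n k b`_n kn (bP n) ndvd (fun i => b`_i) z bP).
rewrite -zE -addrA addrCA -(big_mkord xpredT (fun i => y i *~ b`_i)).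
rewrite -(big_ltn nb) -big_cat_nat ?(ltnW nb)//=.
by rewrite big_mkord.
Qed.

End GenericSequence.

(** * Limits along ultrafilters *)

Section BoundedFunctions.
Variables (R : realType) (T : Type).
Implicit Types f g : T -> R.

Definition bnd f := exists C : R, forall x, `|f x| <= C.

Lemma bnd_cst (c : R) : bnd (fun=> c).
Proof. by exists `|c|. Qed.

Lemma bndD f g : bnd f -> bnd g -> bnd (fun x => f x + g x).
Proof.
move=> [C fC] [D gD]; exists (C + D) => x.
by rewrite (le_trans (ler_normD _ _))// lerD.
Qed.

Lemma bndM f g : bnd f -> bnd g -> bnd (fun x => f x * g x).
Proof.
move=> [C fC] [D gD]; exists (C * D) => x.
by rewrite normrM ler_pM.
Qed.

Lemma bndZ c f : bnd f -> bnd (fun x => c * f x).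
Proof. by apply: bndM; exact: bnd_cst. Qed.

Lemma bndB f g : bnd f -> bnd g -> bnd (fun x => f x - g x).
Proof.
move=> [C fC] [D gD]; exists (C + D) => x.
by rewrite (le_trans (ler_normB _ _))// lerD.
Qed.

Lemma bnd_norm f : bnd f -> bnd (fun x => `|f x|).
Proof. by move=> [C fC]; exists C => x; rewrite normr_id. Qed.

Lemma bnd_sum (J : Type) (r : seq J) (F : J -> T -> R) :
  (forall j, bnd (F j)) -> bnd (fun x => \sum_(j <- r) F j x).
Proof.
move=> bF; elim: r => [|j r IH].
  by under eq_fun do rewrite big_nil; exact: bnd_cst.
by under eq_fun do rewrite big_cons; exact: bndD.
Qed.

Lemma bnd_sub01 f : (forall x, 0 <= f x <= 1) -> bnd f.
Proof. by move=> f01; exists 1 => x; have /andP[? ?] := f01 x; rewrite ger0_norm. Qed.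

End BoundedFunctions.

Section UltraLimit.
Variables (R : realType) (I : Type) (U : set_system I).
Context {UU : UltraFilter U}.
Implicit Types f g : I -> R.

(** A value for every function, meaningful for the bounded ones. *)
Definition ulim f : R := lim (f @ U).

Lemma ulim_cvg f : bnd f -> f @ U --> ulim f.
Proof.
move=> [C fC]; apply/cvg_ex.
have := @segment_compact R (- C) C; rewrite compact_ultra => /(_ (f @ U)).
case.
- split; first exact: fmap_proper_filter.
  move=> H HF UH; rewrite eqEsubset; split => // S HS.
  have [//|nS] := in_ultra_setVsetC (f @^-1` S) UU.
  have /UH HSc : (f @ U) (~` S) by [].
  by have := @filter_not_empty _ H _; rewrite -(setICr S); case; exact: filterI.
- apply: (@filterE _ U) => i /=; rewrite in_itv /= -ler_norml; exact: fC.
- by move=> l [_ fl]; exists l.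
Qed.

Lemma ulimE f l : f @ U --> l -> ulim f = l.
Proof. by move=> fl; exact: cvg_lim. Qed.

Lemma ulim_cst c : ulim (fun=> c) = c.
Proof. by apply: ulimE; exact: cvg_cst. Qed.

Lemma ulimD f g : bnd f -> bnd g -> ulim (fun i => f i + g i) = ulim f + ulim g.
Proof. by move=> bf bg; apply: ulimE; apply: cvgD; exact: ulim_cvg. Qed.

Lemma ulimZ c f : bnd f -> ulim (fun i => c * f i) = c * ulim f.
Proof. by move=> bf; apply: ulimE; apply: cvgM; [exact: cvg_cst|exact: ulim_cvg]. Qed.

Lemma ler_ulim f g : bnd f -> bnd g -> U [set i | f i <= g i] ->
  ulim f <= ulim g.
Proof.
move=> bf bg fg; rewrite -subr_ge0.
apply: (cvgr_to_ge (cvgB (ulim_cvg bg) (ulim_cvg bf))).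
by apply: filterS fg => i /= fgi; rewrite subr_ge0.
Qed.

Lemma ulim_sum (J : Type) (r : seq J) (f : J -> I -> R) :
  (forall j, bnd (f j)) ->
  ulim (fun i => \sum_(j <- r) f j i) = \sum_(j <- r) ulim (f j).
Proof.
move=> bf; elim: r => [|j r IH].
  by under eq_fun do rewrite big_nil; rewrite big_nil ulim_cst.
under eq_fun do rewrite big_cons; rewrite big_cons -IH ulimD//.
exact: bnd_sum.
Qed.

Lemma ulim_gt f c : bnd f -> c < ulim f -> U [set i | c < f i].
Proof.
move=> bf cf; have [//|] := in_ultra_setVsetC [set i | c < f i] UU.
move=> nU; move: cf; rewrite ltNge -(ulim_cst c) => /negP[].
apply: ler_ulim => //; first exact: bnd_cst.
by apply: filterS nU => i /= /negP; rewrite -leNgt.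
Qed.

Lemma ulim_eq f g : bnd f -> bnd g ->
  (forall e, 0 < e -> U [set i | `|f i - g i| <= e]) -> ulim f = ulim g.
Proof.
move=> bf bg fg; apply/eqP; rewrite eq_le.
apply/andP; split; apply/ler_addgt0Pr => e e0;
  rewrite -[X in _ + X]ulim_cst -ulimD//; try exact: bnd_cst; apply: ler_ulim => //;
  try (by apply: bndD => //; exact: bnd_cst);
  by apply: filterS (fg _ e0) => i /=; rewrite ler_norml; lra.
Qed.

End UltraLimit.

Lemma ultra_finite_union (I : Type) (F : set_system I) {FF : UltraFilter F}
    (T : eqType) (E : seq T) (P : T -> set I) :
  F [set n | exists2 e, e \in E & P e n] -> exists2 e, e \in E & F (P e).
Proof.
elim: E => [|e E IH]; first by move=> /filter_ex[n []].
have [Pe _|nPe FE] := in_ultra_setVsetC (P e) FF.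
  by exists e; rewrite ?mem_head.
have [|e' eE Pe'] := IH; last by exists e'; rewrite // inE eE orbT.
apply: filterS (filterI nPe FE) => n /= [nPen [e']].
by rewrite inE => /predU1P[->//|e'E Pe']; exists e'.
Qed.

(** * Averages and invariant means *)

Section Averages.
Variables (R : realType) (G : zmodType).
Implicit Types (f g : G -> R) (Z : seq G).

Definition avg Z f : R := (size Z)%:R^-1 * \sum_(x <- Z) f x.

Lemma avgD Z f g : avg Z (fun x => f x + g x) = avg Z f + avg Z g.
Proof. by rewrite /avg big_split mulrDr. Qed.

Lemma avgZ Z c f : avg Z (fun x => c * f x) = c * avg Z f.
Proof. by rewrite /avg -mulr_sumr mulrCA. Qed.

Lemma avgB Z f g : avg Z (fun x => f x - g x) = avg Z f - avg Z g.
Proof. by rewrite /avg sumrB mulrBr. Qed.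

Lemma avg_cst Z c : Z != [::] -> avg Z (fun=> c) = c.
Proof.
move=> Z0; rewrite /avg big_const_seq count_predT iter_addr_0 -[c *+ _]mulr_natl mulKf//.
by rewrite pnatr_eq0 size_eq0.
Qed.

Lemma ler_avg Z f g : (forall x, f x <= g x) -> avg Z f <= avg Z g.
Proof. by move=> fg; rewrite /avg ler_wpM2l// ?invr_ge0// ler_sum. Qed.

Lemma avg_ge0 Z f : (forall x, 0 <= f x) -> 0 <= avg Z f.
Proof. by move=> f0; rewrite /avg mulr_ge0// ?invr_ge0// sumr_ge0. Qed.

Lemma avg_norm_le Z f C : 0 <= C -> (forall x, `|f x| <= C) -> `|avg Z f| <= C.
Proof.
move=> C0 fC; have [->|Z0] := eqVneq Z [::].
  by rewrite /avg big_nil mulr0 normr0.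
rewrite -(avg_cst C Z0) ler_norml; apply/andP; split.
  rewrite -[X in - X]mul1r -mulNr -avgZ; apply: ler_avg => x.
  by rewrite mulN1r; have := fC x; rewrite ler_norml => /andP[].
by apply: ler_avg => x; have := fC x; rewrite ler_norml => /andP[].
Qed.

Lemma avg_exists_le Z f c : Z != [::] -> avg Z f <= c -> exists x, f x <= c.
Proof.
move=> Z0 fc; apply: contrapT => /forallNP h; move: fc.
rewrite leNgt -subr_gt0 -{1}(avg_cst c Z0) -avgB => /negP; apply.
rewrite /avg mulr_gt0 ?invr_gt0 ?ltr0n ?lt0n ?size_eq0//.
case: Z Z0 => // z Z _; rewrite big_cons ltr_wpDr ?sumr_ge0//.
  by move=> x _; rewrite subr_ge0 ltW// ltNge; exact/negP.
by rewrite subr_gt0 ltNge; exact/negP.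
Qed.

Lemma avg_sum (J : Type) (r : seq J) Z (F : J -> G -> R) :
  avg Z (fun x => \sum_(j <- r) F j x) = \sum_(j <- r) avg Z (F j).
Proof. by rewrite /avg exchange_big mulr_sumr. Qed.

(** The box of all sums of j_e e with j_e < m for e in T, with multiplicity. *)
Fixpoint cube (T : seq G) (m : nat) : seq G :=
  if T is e :: T' then [seq x + e *+ j | j <- iota 0 m, x <- cube T' m]
  else [:: 0].

Lemma size_cube T m : size (cube T m) = (m ^ size T)%N.
Proof. by elim: T => //= e T IH; rewrite size_allpairs size_iota IH expnS. Qed.

Lemma avg_cube_cons e T m f : avg (cube (e :: T) m) f =
  m%:R^-1 * \sum_(j <- iota 0 m) avg (cube T m) (fun x => f (x + e *+ j)).
Proof.
rewrite /avg size_cube expnS /= big_allpairs_dep /= natrM invfM -mulrA mulr_sumr.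
by rewrite size_cube.
Qed.

(** Shifting the box in the direction of a side of length m only exchanges two
    opposite faces. *)
Lemma avg_cube_shift T m f e : (0 < m)%N -> (forall x, `|f x| <= 1) -> e \in T ->
  `|avg (cube T m) (fun x => f (x + e)) - avg (cube T m) f| <= 2 / m%:R.
Proof.
move=> m0; have m0R : 0 < m%:R :> R by rewrite ltr0n.
elim: T f => // e' T IH f f1; rewrite inE => eT.
rewrite !avg_cube_cons -mulrBr -sumrB normrM ger0_norm ?invr_ge0// mulrC.
rewrite ler_pM2r ?invr_gt0//.
have [->|ee'] := eqVneq e e'.
  pose g j := avg (cube T m) (fun x => f (x + e' *+ j)).
  under eq_bigr => j _.
    rewrite -[X in _ - X]/(g j) (_ : avg _ _ = g j.+1); last first.
      by congr avg; apply/funext => x; rewrite mulrSr addrA.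
    over.
  rewrite -[m in iota 0 m]subn0 -/(index_iota 0 m) telescope_sumr//.
  rewrite (le_trans (ler_normB _ _))// (_ : 2 = 1 + 1)// lerD//;
    exact: avg_norm_le.
rewrite (negbTE ee') /= in eT.
rewrite -[2](divfK (lt0r_neq0 m0R)) mulrC.
rewrite (le_trans (ler_norm_sum _ _ _))//.
apply: (@le_trans _ _ (\sum_(j <- iota 0 m) 2 / m%:R)).
  apply: ler_sum => j _.
  have := IH (fun x => f (x + e' *+ j)) _ eT; under eq_fun do rewrite addrAC; exact.
rewrite -[m in iota 0 m]subn0 -/(index_iota 0 m) sumr_const_nat subn0.
by rewrite -[leLHS]mulr_natl.
Qed.

End Averages.

Section Mean.
Variables (R : realType) (G : zmodType).
Implicit Types (f g : G -> R).

(** The directed family of all finite lists of directions; the bound on the size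
    forces the side of the box to grow as well. *)
Definition seq_eventually : set_system (seq G) :=
  [set P | exists S : seq G, forall T : seq G, {subset S <= T} ->
     (size S <= size T)%N -> P T].

Lemma seq_eventually_filter : ProperFilter seq_eventually.
Proof.
apply: Build_ProperFilter_ex; first by move=> P [S SP]; exists S; exact: SP.
split; first by exists [::].
- move=> P Q [S SP] [T TQ]; exists (S ++ T) => V STV; rewrite size_cat => V_size.
  split; [apply: SP|apply: TQ].
  + by move=> x xS; apply: STV; rewrite mem_cat xS.
  + exact: leq_trans (leq_addr _ _) V_size.
  + by move=> x xT; apply: STV; rewrite mem_cat xT orbT.
  + exact: leq_trans (leq_addl _ _) V_size.
- by move=> P Q PQ [S SP]; exists S => T ST szT; apply: PQ; exact: SP.
Qed.

Variable U : set_system (seq G).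
Context {UU : UltraFilter U}.
Hypothesis UE : seq_eventually `<=` U.

Definition box (T : seq G) := cube T (size T).+1.

Lemma box_neq0 T : box T != [::].
Proof. by rewrite -size_eq0 size_cube expn_eq0. Qed.

Lemma avg_box_shift e (c : R) : 0 < c ->
  U [set T | forall f, (forall x, `|f x| <= 1) ->
     `|avg (box T) (fun x => f (x + e)) - avg (box T) f| <= c].
Proof.
move=> c0; apply: UE; pose n := Num.truncn (2 / c).
exists (e :: nseq n e) => T eT; rewrite /= size_nseq => nT f f1 /=.
apply: le_trans (avg_cube_shift _ f1 (eT _ (mem_head _ _))) _ => //.
rewrite ler_pdivrMr ?ltr0n// mulrC -ler_pdivrMr//.
rewrite (le_trans (ltW (truncnS_gt _)))// ler_nat.
exact: leq_trans nT _.
Qed.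

(** An invariant mean, on bounded functions. *)
Definition mean f : R := ulim U (fun T => avg (box T) f).

Lemma bnd_avg f : bnd f -> bnd (fun T => avg (box T) f).
Proof.
move=> [C fC]; exists C => T; apply: avg_norm_le => //.
exact: le_trans (fC 0).
Qed.

Lemma meanD f g : bnd f -> bnd g -> mean (fun x => f x + g x) = mean f + mean g.
Proof.
move=> bf bg; rewrite /mean -ulimD//; try exact: bnd_avg.
by congr ulim; apply/funext => T; rewrite avgD.
Qed.

Lemma meanZ c f : bnd f -> mean (fun x => c * f x) = c * mean f.
Proof.
move=> bf; rewrite /mean -ulimZ//; last exact: bnd_avg.
by congr ulim; apply/funext => T; rewrite avgZ.
Qed.

Lemma mean_cst c : mean (fun=> c) = c.
Proof.
rewrite /mean -[RHS](ulim_cst (U := U)).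
by congr ulim; apply/funext => T; rewrite avg_cst// box_neq0.
Qed.

Lemma ler_mean f g : bnd f -> bnd g -> (forall x, f x <= g x) -> mean f <= mean g.
Proof.
move=> bf bg fg; apply: ler_ulim; try exact: bnd_avg.
by apply: filterE => T; exact: ler_avg.
Qed.

Lemma mean_ge0 f : bnd f -> (forall x, 0 <= f x) -> 0 <= mean f.
Proof.
move=> bf f0; rewrite -(mean_cst 0); apply: ler_mean => //; exact: bnd_cst.
Qed.

Lemma mean_sum (J : Type) (r : seq J) (F : J -> G -> R) :
  (forall j, bnd (F j)) ->
  mean (fun x => \sum_(j <- r) F j x) = \sum_(j <- r) mean (F j).
Proof.
move=> bF; elim: r => [|j r IH].
  by under eq_fun do rewrite big_nil; rewrite big_nil mean_cst.
under eq_fun do rewrite big_cons; rewrite big_cons -IH meanD//.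
exact: bnd_sum.
Qed.

Lemma mean_shift f e : (forall x, `|f x| <= 1) ->
  mean (fun x => f (x + e)) = mean f.
Proof.
move=> f1; apply: ulim_eq; try by apply: bnd_avg; exists 1.
move=> c c0; apply: filterS (avg_box_shift e c0) => T; exact.
Qed.

(** Two invariant means need not commute; a finite average and a mean do. *)
Lemma avg_mean Z (F : G -> G -> R) : (forall x, bnd (F x)) ->
  avg Z (fun x => mean (F x)) = mean (fun t => avg Z (F^~ t)).
Proof.
by move=> bF; rewrite /avg meanZ ?mean_sum//; exact: bnd_sum.
Qed.

End Mean.

(** * Almost periodicity of overlaps *)

Section Overlap.
Variables (R : realType) (G : zmodType) (U : set_system (seq G)).
Context {UU : UltraFilter U}.
Variable A : set G.

Local Notation M := (@mean R G U).

Definition ind x : R := (`[< A x >])%:R.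

(** The correlation of A with the part of its translate A + u inside Z,
    normalized by the size of Z. *)
Definition overlap (Z : seq G) u t := avg Z (fun x => ind (x - u) * ind (x + t)).

Lemma ind_itv x : 0 <= ind x <= 1.
Proof. by rewrite /ind; case: asboolP; rewrite ?lexx ler01. Qed.

Lemma ind2_itv x y : 0 <= ind x * ind y <= 1.
Proof.
have /andP[? ?] := ind_itv x; have /andP[? ?] := ind_itv y.
by rewrite mulr_ge0//= mulr_ile1.
Qed.

Lemma overlap_itv Z u t : 0 <= overlap Z u t <= 1.
Proof.
rewrite avg_ge0 => [|x]; last by have /andP[] := ind2_itv (x - u) (x + t).
rewrite (le_trans (ler_norm _))// avg_norm_le// => x.
by have /andP[? ?] := ind2_itv (x - u) (x + t); rewrite ger0_norm.
Qed.

(** The deviation of one summand from the average. *)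
Let xi Z u x t := ind (x - u) * ind (x + t) - overlap Z u t.

Let bnd_xi Z u x : bnd (xi Z u x).
Proof. by apply: bndB; apply: bnd_sub01 => t; [exact: ind2_itv|exact: overlap_itv]. Qed.

Let bnd_dev Z u (w : seq G) : bnd (fun t => (\sum_(x <- w) xi Z u x t) ^+ 2).
Proof. by under eq_fun do rewrite expr2; apply: bndM; apply: bnd_sum. Qed.

(** The summands are chosen one at a time.  The deviations have average 0 over Z,
    so cross terms vanish on average, and each new summand raises the sum of the
    second moments by at most one for each u; some choice does no worse than
    average. *)
Lemma sampling Z us r : Z != [::] -> exists w : seq G, size w = r /\
  \sum_(u <- us) M (fun t => (\sum_(x <- w) xi Z u x t) ^+ 2) <=
    (r * size us)%:R.
Proof.
move=> Z0; elim: r => [|r [w [sw wP]]].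
  exists [::]; split=> //; rewrite big1// => u _.
  by under eq_fun do rewrite big_nil expr0n; rewrite mean_cst.
pose S u t := \sum_(x <- w) xi Z u x t.
have bS u : bnd (S u) by apply: bnd_sum.
pose Phi x := \sum_(u <- us) M (fun t => (xi Z u x t + S u t) ^+ 2).
have [|x xP] := @avg_exists_le R G Z Phi (r.+1 * size us)%:R Z0; last first.
  exists (x :: w); rewrite /= sw; split=> //.
  by under eq_bigr do under eq_fun do rewrite big_cons.
have bsq u x : bnd (fun t => (xi Z u x t + S u t) ^+ 2).
  by under eq_fun do rewrite expr2; apply: bndM; apply: bndD.
rewrite avg_sum mulSn natrD addrC; apply: le_trans (lerD wP (lexx _)).
rewrite -[X in _ + X%:R]sum1_size natr_sum -big_split /=.
apply: ler_sum => u _; rewrite avg_mean//.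
rewrite -[X in _ + X](mean_cst (U := U)) -meanD//; last exact: bnd_cst.
apply: ler_mean; [|by apply: bndD => //; exact: bnd_cst|move=> t].
  by apply: bndZ; apply: bnd_sum.
rewrite (_ : (fun x => _) =
    fun x => xi Z u x t ^+ 2 + (2 * S u t * xi Z u x t + S u t ^+ 2)); last first.
  by apply/funext => x; ring.
rewrite avgD avgD avgZ avg_cst// avgB avg_cst// -/(overlap Z u t).
rewrite subrr mulr0 add0r addrC.
rewrite lerD// -(avg_cst 1 Z0); apply: ler_avg => x.
have := ind2_itv (x - u) (x + t); have := overlap_itv Z u t.
by rewrite /xi; move: (ind _ * ind _) (overlap _ _ _) => p q /andP[? ?] /andP[? ?]; nra.
Qed.

Definition overlap_dist (Z : seq G) u v :=
  M (fun t => `|overlap Z u t - overlap Z v t|).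

(** Take k ^ 2 samples.  For at least half of the points u of the list the
    sampled average is within 3/(2k) of the overlap in the mean, and the sampled
    average depends only on the k ^ 2 bits telling which of the x - u lie in A.
    If the good points outnumber the patterns, two of them share a pattern. *)
Lemma overlap_dist_close Z us k : Z != [::] -> (0 < k)%N ->
  ((2 ^ (k * k)).*2 < size us)%N ->
  ~~ pairwise (fun u v => 3 / k%:R < overlap_dist Z u v) us.
Proof.
move=> Z0 k0 us_big; have k0R : 0 < k%:R :> R by rewrite ltr0n.
have [w [sw wP]] := sampling us (k * k) Z0.
pose E u := M (fun t => (\sum_(x <- w) xi Z u x t) ^+ 2).
have E0 u : 0 <= E u by apply: mean_ge0 => // t; exact: sqr_ge0.
(* At most half of the points exceed twice the bound on the average. *)
pose good u := E u <= 2 * (k * k)%:R.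
pose bits u := map_tuple (fun x => `[< A (x - u) >]) (in_tuple w).
have bad_le : ((count (predC good) us).*2 <= size us)%N.
  have kk0 : 0 < (k * k)%:R :> R by rewrite ltr0n muln_gt0 k0.
  rewrite -(ler_nat R) -(ler_pM2l kk0) -!natrM; apply: le_trans wP.
  rewrite -muln2 mulnA mulnAC [(_ * 2)%N]mulnC natrM -sum1_count natr_sum.
  rewrite big_mkcond mulr_sumr /=.
  apply: ler_sum => u _; rewrite /good -ltNge; case: ltP => [/ltW|_].
    by rewrite mulr1 (natrM _ 2).
  by rewrite mulr0; exact: E0.
apply/negP => /(subseq_pairwise (filter_subseq good us)) sep.
have : uniq [seq bits u | u <- us & good u].
  rewrite uniq_pairwise pairwise_map.
  move: (filter_all good us) sep; elim: [seq u <- us | good u] => //= u s IH.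
  move=> /andP[gu gs] /andP[us_far sep]; rewrite IH// andbT.
  apply/allP => v vs; have gv := allP gs _ vs.
  apply: contraL (allP us_far _ vs) => /eqP buv; rewrite -leNgt.
  have bsum t : k%:R ^+ 2 * (overlap Z u t - overlap Z v t) =
      \sum_(x <- w) xi Z v x t - \sum_(x <- w) xi Z u x t.
    rewrite /xi !sumrB !big_const_seq !count_predT sw !iter_addr_0.
    rewrite (_ : \sum_(x <- w) ind (x - u) * ind (x + t) =
                 \sum_(x <- w) ind (x - v) * ind (x + t)); last first.
      apply: eq_big_seq => x xw; congr (_ * _).
      by have /eq_in_map/(_ x xw) := congr1 val buv; rewrite /ind => ->.
    by rewrite -[overlap Z u t *+ _]mulr_natr -[overlap Z v t *+ _]mulr_natr natrM; ring.
  (* AM-GM with the scale k, the size of a typical deviation. *)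
  have absE (s0 : R) : `|s0| <= (2 * k%:R)^-1 * s0 ^+ 2 + k%:R / 2.
    rewrite -(ler_pM2l (mulr_gt0 (ltr0n R 2) k0R)) mulrDr mulrA divff ?mul1r; last by lra.
    rewrite -[s0 ^+ 2]real_normK ?num_real//.
    have := sqr_ge0 (`|s0| - k%:R); nra.
  have : overlap_dist Z u v <= (k%:R ^+ 2)^-1 *
      ((2 * k%:R)^-1 * E u + (2 * k%:R)^-1 * E v + k%:R).
    have bE x : bnd (fun t => (2 * k%:R)^-1 * (\sum_(y <- w) xi Z x y t) ^+ 2).
      exact: bndZ.
    rewrite /overlap_dist -[X in _ + X](mean_cst (U := U)) -!meanZ//.
    rewrite -!meanD//; last 2 first.
      by apply: bndD.
      exact: bnd_cst.
    rewrite -meanZ; last by apply: bndD; [apply: bndD|exact: bnd_cst].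
    apply: ler_mean => [||t].
    - by apply: bnd_norm; apply: bndB; apply: bnd_sub01 => t; exact: overlap_itv.
    - by apply: bndZ; apply: bndD; [apply: bndD|exact: bnd_cst].
    rewrite -(ler_pM2l (exprn_gt0 2 k0R)) mulrA divff ?mul1r ?expf_neq0 ?gt_eqF//.
    rewrite -[X in X * `|_|]gtr0_norm ?exprn_gt0// -normrM bsum.
    rewrite (le_trans (ler_normB _ _))//.
    have := absE (\sum_(x <- w) xi Z u x t); have := absE (\sum_(x <- w) xi Z v x t).
    lra.
  have k_neq0 : k%:R != 0 :> R by rewrite gt_eqF.
  have goodE x : good x -> (2 * k%:R)^-1 * E x <= k%:R.
    by rewrite /good natrM ler_pdivrMl ?mulr_gt0// => /le_trans; apply; lra.
  move=> /le_trans; apply; have := goodE _ gu; have := goodE _ gv => gv' gu'.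
  rewrite (_ : 3 / k%:R = (k%:R ^+ 2)^-1 * (k%:R + k%:R + k%:R)); last by field.
  by rewrite ler_pM2l ?invr_gt0 ?exprn_gt0// !lerD.
move=> /card_uniqP bits_uniq.
have := max_card [in [seq bits u | u <- us & good u]].
rewrite bits_uniq card_tuple card_bool size_map size_filter sw leqNgt => /negP; apply.
rewrite -(ltn_pmul2r (isT : (0 < 2)%N)) !muln2 (leq_trans us_big)//.
move: bad_le (count_predC good us); move: (count _ us) (count _ us) => b g.
by lia.
Qed.
End Overlap.

(** * Foelner's theorem *)

Record pseudonorm (R : realType) (G : zmodType) (q : G -> R) : Prop := {
  pseudonorm0 : q 0 = 0;
  pseudonormN : forall x, q (- x) = q x;
  pseudonormD : forall x y, q (x + y) <= q x + q y;
  pseudonorm_bnd : bnd q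
}.

Section PseudonormTheory.
Variables (R : realType) (G : zmodType) (q : G -> R).
Hypothesis q_norm : pseudonorm q.

Lemma pseudonorm_ge0 x : 0 <= q x.
Proof.
have := pseudonormD q_norm x (- x).
by rewrite subrr (pseudonorm0 q_norm) (pseudonormN q_norm); lra.
Qed.

Lemma pseudonorm_sum (J : Type) (r : seq J) (f : J -> G) :
  q (\sum_(j <- r) f j) <= \sum_(j <- r) q (f j).
Proof.
elim: r => [|j r IH]; first by rewrite !big_nil (pseudonorm0 q_norm).
by rewrite !big_cons (le_trans (pseudonormD q_norm _ _))// lerD2l.
Qed.

Lemma pseudonormMz x (n : int) : q (x *~ n) <= `|n|%:~R * q x.
Proof.
have qMn (m : nat) : q (x *+ m) <= m%:R * q x.
  elim: m => [|m IH]; first by rewrite mulr0n mul0r (pseudonorm0 q_norm).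
  rewrite mulrS (le_trans (pseudonormD q_norm _ _))// -natr1 mulrDl mul1r.
  by rewrite addrC lerD2r.
case: n => n; first exact: qMn.
by rewrite NegzE mulrNz (pseudonormN q_norm) normrN; exact: qMn.
Qed.

End PseudonormTheory.

(** Total boundedness is covering by finitely many translates of each ball. *)
Definition totally_bounded (R : realType) (G : zmodType) (q : G -> R) :=
  forall e, 0 < e -> covered [set x | q x < e] 1.

Section Folner.
Variables (R : realType) (G : zmodType) (U : set_system (seq G)).
Context {UU : UltraFilter U}.
Hypothesis UE : @seq_eventually G `<=` U.
Variable A : set G.

Local Notation M := (@mean R G U).
Local Notation ov := (@overlap R G A).
Local Notation od := (@overlap_dist R G U A).

Let bnd_ov Z u : bnd (ov Z u).
Proof. by apply: bnd_sub01 => t; exact: overlap_itv. Qed.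

Let bnd_ovB Z u v : bnd (fun t => `|ov Z u t - ov Z v t|).
Proof. by apply: bnd_norm; exact: bndB. Qed.

Lemma overlap_distC Z u v : od Z u v = od Z v u.
Proof. by rewrite /overlap_dist; under eq_fun do rewrite distrC. Qed.

Lemma overlap_distD Z u v w : od Z u w <= od Z u v + od Z v w.
Proof.
rewrite -meanD//; apply: ler_mean => //; first exact: bndD.
by move=> t; exact: ler_distD.
Qed.

Lemma overlap_dist_itv Z u v : 0 <= od Z u v <= 1.
Proof.
apply/andP; split; first exact: mean_ge0.
rewrite -(mean_cst (R := R) (U := U) 1); apply: ler_mean => //; first exact: bnd_cst.
move=> t; have := overlap_itv R A Z u t; have := overlap_itv R A Z v t.
by rewrite ler_norml; lra.
Qed.

(** Both arguments move by s: the average over the box absorbs one shift up to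
    an error that vanishes in the limit, the invariant mean absorbs the other
    exactly. *)
Lemma overlap_dist_shift u v s e : 0 < e ->
  U [set T | `|od (box T) (u + s) (v + s) - od (box T) u v| <= e].
Proof.
move=> e0.
have near w : U [set T | forall t,
    `|ov (box T) (w + s) t - ov (box T) w (t + s)| <= e / 2].
  apply: filterS (avg_box_shift UE (- s) (divr_gt0 e0 (ltr0n R 2))) => T Ts t.
  pose f x := ind R A (x - w) * ind R A (x + (t + s)).
  have -> : ov (box T) (w + s) t = avg (box T) (fun x => f (x - s)).
    congr avg; apply/funext => x; rewrite /f opprD addrA addrAC.
    by rewrite addrACA addNr addr0.
  by apply: Ts => x; have /andP[? ?] := ind2_itv R A (x - w) (x + (t + s));
    rewrite ger0_norm.
apply: filterS (filterI (near u) (near v)) => T [/= uT vT].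
pose g t := `|ov (box T) u t - ov (box T) v t|.
have g1 t : `|g t| <= 1.
  rewrite /g normr_id; have := overlap_itv R A (box T) u t.
  by have := overlap_itv R A (box T) v t; rewrite ler_norml; lra.
rewrite -[X in _ - X]/(M g) -(mean_shift UE s g1) -mulN1r -meanZ; last by exists 1.
rewrite -meanD//; last by apply: bndZ; exists 1.
rewrite ler_norml -[X in _ <= _ <= X](mean_cst (R := R) (U := U)).
rewrite -[X in X <= _ <= _](mean_cst (R := R) (U := U)).
have h t : `| `|ov (box T) (u + s) t - ov (box T) (v + s) t| - g (t + s)| <= e.
  have := uT t; have := vT t; rewrite /g.
  set a := ov _ (u + s) t; set b := ov _ u (t + s).
  set c := ov _ (v + s) t; set d := ov _ v (t + s) => cd ab.
  rewrite (le_trans (ler_dist_dist _ _))//.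
  rewrite (_ : _ - _ = (a - b) - (c - d)); last by ring.
  by rewrite (le_trans (ler_normB _ _))//; lra.
have bg : bnd (fun t =>
    `|ov (box T) (u + s) t - ov (box T) (v + s) t| + -1 * g (t + s)).
  by apply: bndD => //; apply: bndZ; exists 1.
by apply/andP; split; apply: ler_mean => //; try exact: bnd_cst;
  move=> t; have := h t; rewrite ler_norml mulN1r => /andP[].
Qed.

(** An invariant pseudometric: the shift errors vanish in the limit over the
    boxes. *)
Definition density_dist u v : R := ulim U (fun T => od (box T) u v).

Let bnd_od u v : bnd (fun T => od (box T) u v).
Proof. by apply: bnd_sub01 => T; exact: overlap_dist_itv. Qed.

Lemma density_distC u v : density_dist u v = density_dist v u.
Proof. by rewrite /density_dist; under eq_fun do rewrite overlap_distC. Qed.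

Lemma density_distD u v w :
  density_dist u w <= density_dist u v + density_dist v w.
Proof.
rewrite -ulimD//; apply: ler_ulim => //; first exact: bndD.
by apply: filterE => T; exact: overlap_distD.
Qed.

Lemma density_dist_shift u v s :
  density_dist (u + s) (v + s) = density_dist u v.
Proof. by apply: ulim_eq => //; exact: overlap_dist_shift. Qed.

Definition density_norm s := density_dist 0 s.

Lemma density_distE u v : density_dist u v = density_norm (v - u).
Proof. by rewrite -(density_dist_shift u v (- u)) subrr. Qed.

Lemma density_norm_pseudonorm : pseudonorm density_norm.
Proof.
split.
- rewrite /density_norm /density_dist -[RHS](ulim_cst (U := U)).
  congr ulim; apply/funext => T; rewrite /overlap_dist.
  by under eq_fun do rewrite subrr normr0; rewrite mean_cst.
- move=> x.
  by rewrite -[in RHS](subr0 x) -density_distE density_distC density_distE sub0r.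
- move=> x y; rewrite (le_trans (density_distD 0 x _))// lerD2l density_distE.
  by rewrite addrAC subrr add0r.
- exists 1 => s; rewrite ger0_norm.
    by rewrite -(ulim_cst (U := U) 1); apply: ler_ulim => //; [exact: bnd_cst|];
      apply: filterE => T; have /andP[] := overlap_dist_itv (box T) 0 s.
  by rewrite -(ulim_cst (U := U) 0); apply: ler_ulim => //; [exact: bnd_cst|];
    apply: filterE => T; have /andP[] := overlap_dist_itv (box T) 0 s.
Qed.

(** A list of e-separated points would, for almost all boxes, be separated for
    the distance attached to that box, which bounds its length. *)
Lemma density_norm_totally_bounded : totally_bounded density_norm.
Proof.
move=> e e0.
pose k := (Num.truncn (3 / e)).+1.
have ke : 3 / k%:R < e.
  by rewrite ltr_pdivrMr ?ltr0n// mulrC -ltr_pdivrMr//; exact: truncnS_gt.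
apply: contrapT => ncov.
have [us us_size us_far] : exists2 us : seq G, size us = (2 ^ (k * k)).*2.+1 &
    pairwise (fun u v => e <= density_dist u v) us.
  elim: (_.+1) => [|n [us us_size us_far]]; first by exists [::].
  have /existsNP[x xP] : ~ forall x, exists2 f, f \in us & density_norm (x *~ 1 - f) < e.
    by move=> h; apply: ncov; exists us.
  exists (x :: us); rewrite /= ?us_size// us_far andbT.
  apply/allP => u uus; rewrite leNgt; apply/negP => xu; apply: xP; exists u => //.
  by rewrite mulr1z -density_distE density_distC.
suff : U [set T | pairwise (fun u v => 3 / k%:R < od (box T) u v) us].
  move=> /filter_ex[T /=]; apply/negP; apply: overlap_dist_close => //.
    exact: box_neq0.
  by rewrite us_size.
move: us_far; elim: us {us_size} => [|u us IH] /=; first by move=> _; exact: filterE.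
move=> /andP[u_far /IH us_near].
suff u_near : U [set T | all (fun v => 3 / k%:R < od (box T) u v) us].
  by apply: filterS (filterI u_near us_near) => T [/= -> ->].
move: u_far; elim: us {IH us_near} => [|v us IH] /=; first by move=> _; exact: filterE.
move=> /andP[uv /IH us_near].
have uv_near : U [set T | 3 / k%:R < od (box T) u v].
  exact: ulim_gt (bnd_od u v) (lt_le_trans ke uv).
by apply: filterS (filterI uv_near us_near) => T [/= -> ->].
Qed.

(** If s is not in the double difference set, the overlaps for 0 and for s have
    disjoint supports, so their distance is at least the mean of the first, which
    is the square of the density of A in the limit; and finitely many translates
    of A cover, so the density is positive. *)
Lemma density_norm_small : covered A 1 ->
  exists2 d, 0 < d & forall s, density_norm s < d -> diffset (diffset A) s.
Proof.
move=> [F FA]; pose a := ind R A.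
have ba : bnd a by apply: bnd_sub01; exact: ind_itv.
have a1 x : `|a x| <= 1 by have /andP[? ?] := ind_itv R A x; rewrite ger0_norm.
have Ma_gt0 : 0 < M a.
  have : 1 <= (size F)%:R * M a.
    have bsum : bnd (fun x => \sum_(f <- F) a (x - f)).
      by apply: bnd_sum => f; exists 1.
    rewrite -[leLHS](mean_cst (R := R) (U := U)).
    apply: le_trans (_ : M (fun x => \sum_(f <- F) a (x - f)) <= _).
      apply: ler_mean => // [|x]; first exact: bnd_cst.
      have [f fF Af] := FA x; rewrite (big_rem f)//= /a /ind asboolT ?lerDl//.
      by apply: sumr_ge0 => g _; have /andP[] := ind_itv R A (x - g).
    rewrite mean_sum; last by move=> f; exists 1.
    rewrite (eq_bigr (fun=> M a)); last by move=> f _; exact: mean_shift.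
    by rewrite big_const_seq count_predT iter_addr_0 mulr_natl.
  have : 0 <= M a by apply: mean_ge0 => // x; have /andP[] := ind_itv R A x.
  by rewrite le_eqVlt => /predU1P[<-|//]; rewrite mulr0 ler10.
exists (M a * M a); first exact: mulr_gt0.
move=> s; apply: contraPP => nDs; apply/negP; rewrite -leNgt -ulimZ; last exact: bnd_avg.
apply: ler_ulim => //; first by apply: bndZ; exact: bnd_avg.
apply: filterE => T /=.
rewrite [leLHS](_ : _ = M (ov (box T) 0)); last first.
  rewrite -avg_mean => [|x]; last by apply: bnd_sub01 => t; exact: ind2_itv.
  rewrite -avgZ; congr avg; apply/funext => x.
  rewrite meanZ; last by exists 1.
  under eq_fun do rewrite [x + _]addrC.
  by rewrite mean_shift// subr0 mulrC.
apply: ler_mean => // t.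
have [->|ov0] := eqVneq (ov (box T) 0 t) 0; first exact: normr_ge0.
suff -> : ov (box T) s t = 0 by rewrite subr0 ler_norm.
apply: contraTeq ov0 => ovs; rewrite negbK.
have nz u : ov (box T) u t != 0 -> exists x, A (x - u) /\ A (x + t).
  move=> ovu; apply: contrapT => /forallNP noA; move/eqP : ovu; apply.
  rewrite /overlap (_ : (fun x => _) = fun=> 0) ?avg_cst ?box_neq0//.
  apply/funext => x; rewrite /ind.
  case: asboolP => [Au|]; rewrite ?mul0r//; case: asboolP => [At|]; rewrite ?mulr0//.
  by have := noA x; case.
apply/negPn/negP => /nz[x]; rewrite subr0 => -[Ax Axt].
have [z [Azs Azt]] := nz _ ovs; apply: nDs.
rewrite (_ : s = (z + t - (x + t)) - (z - s - x)).
  by apply: diffsetP; exact: diffsetP.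
rewrite [- (x + t)]opprD [z + t + _]addrACA subrr addr0 [z - s - x]addrAC opprB.
by rewrite [RHS]addrC subrK.
Qed.

End Folner.

(** Foelner's theorem, with a totally bounded pseudonorm instead of finitely many
    characters. *)
Theorem folner (R : realType) (G : zmodType) (A : set G) : covered A 1 ->
  exists q : G -> R, [/\ pseudonorm q, totally_bounded q &
    exists2 d, 0 < d & forall s, q s < d -> diffset (diffset A) s].
Proof.
move=> covA; have [U [UU UE]] := ultraFilterLemma (seq_eventually_filter G).
exists (@density_norm R G U A); split.
- exact: density_norm_pseudonorm.
- exact: density_norm_totally_bounded.
- exact: density_norm_small.
Qed.

(** * A coarser topology from an independent sequence *)

Section Weights.
Variable R : realType.
Implicit Types (w : nat -> R) (b c : {poly int}).

(** A weighted l1 norm on the free group. *)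
Definition weight w b : R := \sum_(i < size b) `|b`_i|%:~R * w i.

Lemma weight_widen M w b : (size b <= M)%N ->
  weight w b = \sum_(i < M) `|b`_i|%:~R * w i.
Proof.
move=> bM; rewrite /weight (big_ord_widen _ (fun i => `|b`_i|%:~R * w i) bM).
rewrite big_mkcond; apply: eq_bigr => i _; case: ltnP => // /(nth_default 0) ->.
by rewrite normr0 mul0r.
Qed.

Lemma ler_weight w w' b c : (forall i, 0 <= w i <= w' i) ->
  (forall i, `|b`_i| <= `|c`_i|) -> weight w b <= weight w' c.
Proof.
move=> ww' bc; pose M := maxn (size b) (size c).
rewrite !(@weight_widen M) ?leq_max ?leqnn ?orbT//.
by apply: ler_sum => i _; have /andP[? ?] := ww' i; rewrite ler_pM// ler_int.
Qed.

Lemma weightB w b c : (forall i, 0 <= w i) ->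
  weight w (b - c) <= weight w b + weight w c.
Proof.
move=> w0; pose M := maxn (size b) (maxn (size c) (size (b - c))).
rewrite !(@weight_widen M) ?leq_max ?leqnn ?orbT// -big_split /=.
apply: ler_sum => i _; rewrite coefB -mulrDl ler_wpM2r// -intrD ler_int.
exact: ler_normB.
Qed.

Lemma weightD w w' b : weight (fun i => w i + w' i) b = weight w b + weight w' b.
Proof. by rewrite /weight -big_split; apply: eq_bigr => i _; rewrite mulrDr. Qed.

Lemma weightZ a w b : weight (fun i => a * w i) b = a * weight w b.
Proof. by rewrite /weight mulr_sumr; apply: eq_bigr => i _; rewrite mulrCA. Qed.

Lemma weight_ge0 w b : (forall i, 0 <= w i) -> 0 <= weight w b.
Proof. by move=> w0; apply: sumr_ge0 => i _; rewrite mulr_ge0// ler0z. Qed.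

Lemma weight0 w : weight w 0 = 0.
Proof. by rewrite /weight size_poly0 big_ord0. Qed.

Lemma weightXn w n : weight w 'X^n = w n.
Proof.
rewrite /weight size_polyXn big_ord_recr /= coefXn eqxx normr1 mul1r.
by rewrite big1 ?add0r// => i _; rewrite coefXn ltn_eqF ?normr0 ?mul0r.
Qed.

Lemma coef_weight w b i : (forall i, 0 <= w i) -> `|b`_i|%:~R * w i <= weight w b.
Proof.
move=> w0; rewrite (@weight_widen (maxn (size b) i.+1)) ?leq_max ?leqnn ?orbT//.
have iM : (i < maxn (size b) i.+1)%N by rewrite leq_max ltnSn orbT.
rewrite (bigD1 (Ordinal iM))//= lerDl; apply: sumr_ge0 => j _.
by rewrite mulr_ge0// ler0z.
Qed.

End Weights.

Section CoarserTopology.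
Variables (R : realType) (Z : zmodType) (N : set_system Z).
Hypothesis gN : group_nbhs N.
Variables (F : set_system nat).
Context {FF : UltraFilter F}.
Hypothesis F_oo : forall n, F [set m | (n <= m)%N].
Variable y : nat -> Z.
Implicit Types (w : nat -> R) (b c : {poly int}).

#[local] Instance N_filt : Filter N := group_nbhs_filter gN.

Definition vanishing w :=
  (forall n, 0 <= w n) /\ forall e, 0 < e -> F [set n | w n < e].

Lemma vanishingD w w' : vanishing w -> vanishing w' ->
  vanishing (fun n => w n + w' n).
Proof.
move=> [w0 we] [w'0 w'e]; split=> [n|e e0]; first exact: addr_ge0.
have e2 : 0 < e / 2 by rewrite divr_gt0.
by apply: filterS (filterI (we _ e2) (w'e _ e2)) => n [/=]; lra.
Qed.

Lemma vanishing_double w : vanishing w -> vanishing (fun n => 2 * w n).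
Proof. by move=> vw; under eq_fun do rewrite mulr_natl mulr2n; exact: vanishingD. Qed.

Lemma vanishing_step M : vanishing (fun n => (n < M)%:R).
Proof.
split=> // e e0; apply: filterS (F_oo M) => n /=.
by rewrite leqNgt => /negbTE ->.
Qed.

Lemma vanishing_harmonic : vanishing (fun n => n.+1%:R^-1).
Proof.
split=> [n|e e0]; first by rewrite invr_ge0.
apply: filterS (F_oo (Num.truncn e^-1)) => n /= en.
rewrite -[ltRHS]invrK ltf_pV2 ?posrE ?invr_gt0//.
by rewrite (lt_le_trans (truncnS_gt _))// ler_nat.
Qed.

(** Coefficient sum zero: only the differences of the terms of y are made small,
    so that y becomes Cauchy rather than a null sequence. *)
Definition coarser_nbhs : set_system Z :=
  [set S | exists2 w, vanishing w & exists2 V, N V &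
    forall b v, b.[1] = 0 -> weight w b < 1 -> V v -> S (combination y b + v)].

Lemma coarser_group_nbhs : group_nbhs coarser_nbhs.
Proof.
split.
- split.
  + exists (fun n => (n < 0)%:R); first exact: vanishing_step.
    by exists setT => //; exact: filterT.
  + move=> S T [w vw [V NV VS]] [w' vw' [V' NV' VT]].
    exists (fun n => w n + w' n); first exact: vanishingD.
    exists (V `&` V'); first exact: filterI.
    move=> b v b1 wb [Vv V'v]; have [w0 _] := vw; have [w'0 _] := vw'.
    by split; [apply: VS|apply: VT] => //; apply: le_lt_trans wb;
      apply: ler_weight => // i; rewrite ?w0 ?w'0 ?lerDl ?lerDr ?w0 ?w'0.
  + move=> S T ST [w vw [V NV VS]]; exists w => //; exists V => // b v b1 wb Vv.
    exact/ST/VS.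
- move=> S [w vw [V NV VS]].
  have := VS 0 0; rewrite horner0 weight0 ltr01 combination0 addr0; apply => //.
  exact: (group_nbhs0 gN NV).
- move=> S [w vw [V NV VS]]; have [V' NV' V'V] := group_nbhsB gN NV.
  exists [set z | exists b v, [/\ z = combination y b + v, b.[1] = 0,
      weight (fun n => 2 * w n) b < 1 & V' v]].
    exists (fun n => 2 * w n); first exact: vanishing_double.
    by exists V' => // b v b1 wb V'v; exists b, v.
  move=> _ _ [b [v [-> b1 wb V'v]]] [c [u [-> c1 wc V'u]]].
  rewrite opprD addrACA -combinationB; apply: VS.
  + by rewrite hornerD hornerN b1 c1 subrr.
  + have [w0 _] := vw; apply: le_lt_trans (weightB _ _ w0) _.
    by move: wb wc; rewrite !weightZ; lra.
  + exact: V'V.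
Qed.

Lemma coarser_nbhs_sub : coarser_nbhs `<=` N.
Proof.
move=> S [w vw [V NV VS]]; apply: filterS NV => v Vv.
by have := VS 0 v; rewrite horner0 weight0 ltr01 combination0 add0r; exact.
Qed.

Definition sequence_filter : set_system Z := [set S | F [set n | S (y n)]].

Lemma sequence_filter_cauchy : cauchy_for coarser_nbhs sequence_filter.
Proof.
move=> S [w [w0 we] [V NV VS]].
exists [set y n | n in [set n | w n < 2^-1]].
  by apply: (@filterS _ F) (we 2^-1 _); [move=> n wn; exists n|rewrite invr_gt0].
move=> _ _ [n /= wn <-] [m /= wm <-].
have := VS ('X^n - 'X^m) 0; rewrite combinationB !combinationXn addr0; apply.
- by rewrite hornerD hornerN !hornerXn !expr1n subrr.
- by apply: le_lt_trans (weightB _ _ w0) _; rewrite !weightXn; lra.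
- exact: (group_nbhs0 gN NV).
Qed.

(** A point of the intersection of all coarser neighbourhoods is approximable
    with s = 0, a limit of y with s = 1; both cases rest on the same argument. *)
Definition approximable (s : int) x := forall w V, vanishing w -> N V ->
  exists b, [/\ b.[1] = s, weight w b < 1 & V (x - combination y b)].

Lemma limit_approximable x :
  converges_to coarser_nbhs sequence_filter x -> approximable 1 x.
Proof.
move=> yx w V vw NV; have [w0 we] := vw.
pose S := [set z | exists b v, [/\ z = combination y b + v, b.[1] = 0,
      weight (fun n => 2 * w n) b < 1 & V (- v)]].
have /yx : coarser_nbhs S.
  exists (fun n => 2 * w n); first exact: vanishing_double.
  exists [set v | V (- v)]; first exact: (group_nbhsN gN NV).
  by move=> b v b1 wb Vv; exists b, v.
have half0 : 0 < 2^-1 :> R by rewrite invr_gt0.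
move=> /(@filterI _ F _ _ _ (we _ half0))/filter_ex[n /= [wn [b [v [yn b1 wb Vv]]]]].
exists ('X^n - b); split.
- by rewrite hornerD hornerN hornerXn expr1n b1 subr0.
- apply: le_lt_trans (weightB _ _ w0) _; rewrite weightXn.
  by move: wb; rewrite weightZ; lra.
- rewrite combinationB combinationXn opprB addrA addrAC.
  suff -> : x - y n + combination y b = - v by [].
  by rewrite -[x - y n]opprB yn opprD addrAC addNr add0r.
Qed.

Lemma intersection_approximable x :
  (forall S, coarser_nbhs S -> S x) -> approximable 0 x.
Proof.
move=> Sx w V vw NV.
have [] := Sx [set z | exists b v, [/\ z = combination y b + v, b.[1] = 0,
      weight w b < 1 & V v]].
  by exists w => //; exists V => // b v b1 wb Vv; exists b, v.
move=> b [v [-> b1 wb Vv]]; exists b; split=> //.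
by rewrite addrC addKr.
Qed.

End CoarserTopology.

Section PolynomialPseudonorm.
Variables (R : realType) (F : set_system nat).
Context {FF : UltraFilter F}.
Variable q : {poly int} -> R.
Hypothesis q_norm : pseudonorm q.

(** The distance from the monomial of degree n to an ideal limit of the
    monomials. *)
Definition limit_weight n := ulim F (fun m => q ('X^n - 'X^m)).

Let bnd_qX n : bnd (fun m => q ('X^n - 'X^m)).
Proof. by have [C qC] := pseudonorm_bnd q_norm; exists C. Qed.

(** In a totally bounded pseudonorm every sequence is Cauchy along an
    ultrafilter. *)
Lemma vanishing_limit_weight : totally_bounded q -> vanishing F limit_weight.
Proof.
move=> q_tb; split=> [n|e e0].
  rewrite -(ulim_cst (R := R) (U := F) 0); apply: ler_ulim => //; first exact: bnd_cst.
  by apply: filterE => m; exact: pseudonorm_ge0 q_norm _.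
have [E EP] := q_tb _ (divr_gt0 e0 (ltr0n R 3)).
have [|f fE Pf] := @ultra_finite_union _ F _ _ E (fun f n => q ('X^n - f) < e / 3).
  by apply: filterE => n /=; have [f fE] := EP 'X^n; rewrite mulr1z; exists f.
apply: filterS (Pf) => n qn /=.
apply: (@le_lt_trans _ _ (e / 3 + e / 3)); last by lra.
rewrite -[leRHS](ulim_cst (U := F)); apply: ler_ulim => //; first exact: bnd_cst.
apply: filterS Pf => m /= qm.
rewrite (_ : _ - _ = ('X^n - f) + - ('X^m - f)); last by rewrite opprB addrA subrK.
by rewrite (le_trans (pseudonormD q_norm _ _))// (pseudonormN q_norm) lerD// ltW.
Qed.

(** A coefficient sum of zero allows each monomial to be replaced by its difference
    with a fixed one of degree m; then m goes to the limit. *)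
Lemma pseudonorm_le_weight c : c.[1] = 0 -> q c <= weight limit_weight c.
Proof.
move=> c1; rewrite /weight (eq_bigr (fun i : 'I_(size c) =>
    ulim F (fun m => `|c`_i|%:~R * q ('X^i - 'X^m)))); last by move=> i _; rewrite ulimZ.
rewrite -ulim_sum; last by move=> i; exact: bndZ.
rewrite -[leLHS](ulim_cst (U := F)); apply: ler_ulim; first exact: bnd_cst.
  by apply: bnd_sum => i; exact: bndZ.
apply: filterE => m /=.
have {1}-> : c = \sum_(i < size c) ('X^i - 'X^m) *~ c`_i.
  under eq_bigr do rewrite mulrzBl; rewrite sumrB -mulrz_sumr.
  have -> : \sum_(i < size c) c`_i = 0.
    by rewrite -[RHS]c1 horner_coef; apply: eq_bigr => i _; rewrite expr1n mulr1.
  rewrite mulr0z subr0 -[LHS]coefK poly_def; apply: eq_bigr => i _.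
  rewrite -mulrzr -mul_polyC mulrC; congr (_ * _).
  by rewrite -[in LHS](intz c`_i) rmorph_int.
by rewrite (le_trans (pseudonorm_sum q_norm _ _))// ler_sum// => i _; exact: pseudonormMz.
Qed.

End PolynomialPseudonorm.

Section GenericTopology.
Variables (R : realType) (Z : zmodType) (N : set_system Z).
Hypothesis gN : group_nbhs N.
Variables (F : set_system nat).
Context {FF : UltraFilter F}.
Hypothesis F_oo : forall n, F [set m | (n <= m)%N].
Variables (y : nat -> Z) (lv : nat -> nat) (U : nat -> set Z).
Hypothesis NU : forall k, N (U k).
Hypothesis y_dvd : forall k (b : {poly int}),
  (forall i, (`|(b`_i)%R| <= i)%N) -> U k (combination y b) ->
  forall n, (k <= n)%N -> ((lv k)%:Z %| b`_n)%Z.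

#[local] Instance N_fil : Filter N := group_nbhs_filter gN.
Local Notation approximable := (@approximable R Z N F y).

(** First approximate x by some combination b.  Then approximate it by c, with a
    weight of at least 1 at all indices below k or in the support of b, so that c
    vanishes there.  The difference b - c has a combination in U k, so from k on
    its coefficients are divisible by lv k, and outside the support of b these are
    the coefficients of c up to sign. *)
Lemma approximable_dvd s x k (w : nat -> R) V : approximable s x ->
  vanishing F w -> N V ->
  exists b, [/\ b.[1] = s, weight w b < 1, V (x - combination y b) &
    forall i, ((lv k)%:Z %| b`_i)%Z].
Proof.
move=> apx vw NV; have [V' NV' V'U] := group_nbhsB gN (NU k).
have vh : vanishing F (fun n => n.+1%:R^-1 : R) by exact: vanishing_harmonic.
have [h0 _] := vh.
pose h n : R := n.+1%:R^-1.
have [b [_ wb V'b]] := apx _ _ (vanishing_double vh) NV'.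
pose M := maxn k (size b).
(* The harmonic part bounds the coefficient at i by i, as the independence of y
   requires; the step below M kills the coefficients of c there. *)
have vw' : vanishing F (fun n => 2 * h n + w n + (n < M)%:R).
  apply: vanishingD (vanishing_step R F_oo M).
  by apply: vanishingD => //; exact: vanishing_double.
have [c [cs wc [Vc V'c]]] := apx _ _ vw' (filterI NV NV').
have [w0 _] := vw.
have w'0 := vw'.1.
move: wc; rewrite 2!weightD => wc.
have c0 : 0 <= weight (fun n => 2 * h n) c.
  by apply: weight_ge0 => n; rewrite mulr_ge0//; exact: h0.
have c1 : 0 <= weight w c by exact: weight_ge0.
have c2 : 0 <= weight (fun n => (n < M)%:R : R) c by apply: weight_ge0.
exists c; split=> //; first by lra.
have bound i : (`|((b - c)`_i)%R| <= i)%N.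
  have hi := @coef_weight R h (b - c) i h0.
  have : weight h (b - c) < 1.
    by apply: le_lt_trans (weightB _ _ h0) _; move: wb wc c0; rewrite !weightZ; lra.
  move=> /(le_lt_trans hi); rewrite /h ltr_pdivrMr ?mul1r// => hlt.
  by move: hlt; rewrite -[i.+1%:R]/(i.+1%:Z%:~R) ltr_int; lia.
have Ubc : U k (combination y (b - c)).
  rewrite combinationB (_ : _ - _ = (x - combination y c) - (x - combination y b)).
    exact: V'U.
  by rewrite opprB [RHS]addrC addrA subrK.
move=> i; have [iM|Mi] := ltnP i M.
  suff -> : c`_i = 0 by rewrite dvdz0.
  have := @coef_weight R (fun n => (n < M)%:R) c i (fun=> ler0n _ _).
  rewrite iM mulr1 => ci.
  have : `|c`_i|%:~R < 1%:~R :> R by apply: le_lt_trans ci _; lra.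
  by rewrite ltr_int; lia.
have := y_dvd bound Ubc (leq_trans (leq_maxl _ _) Mi).
by rewrite coefB nth_default ?(leq_trans (leq_maxr _ _) Mi)// sub0r rpredN.
Qed.

Lemma not_approximable1 x k : lv k != 1%N -> ~ approximable 1 x.
Proof.
move=> lvk apx.
have [b [b1 _ _ bdvd]] := approximable_dvd k apx (vanishing_step R F_oo 0)
  filterT.
have : ((lv k)%:Z %| b.[1])%Z.
  by rewrite horner_coef; apply: rpred_sum => i _; rewrite expr1n mulr1.
rewrite b1 dvdz1 /=; exact/negP.
Qed.

Hypothesis lv_cofinal : forall V, N V -> exists k, covered V (lv k).

(** Every neighbourhood V contains x.  For a level whose multiples are covered by
    a small B1, the approximating combination is a multiple of lv k, and Foelner's
    theorem applies to the c for which lv k times the combination of c is small.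
    The resulting pseudonorm is dominated by a vanishing weight, so the
    combination falls into V. *)
Lemma approximable0 x : separated_nbhs N -> approximable 0 x -> x = 0.
Proof.
move=> sepN apx; apply: sepN => V NV.
have [B NB BV] := group_nbhs_diffset2 gN NV.
have [B1 NB1 B1B] := group_nbhsB gN NB.
have [k [E EP]] := lv_cofinal NB1.
pose A := [set c : {poly int} | B (combination y c *~ (lv k)%:Z)].
have covA : covered A 1.
  have /choice[r rP] f : exists c0, forall c,
      B1 (combination y c *~ (lv k)%:Z - f) -> A (c - c0).
    have [[c0 Bc0]|noc] :=
        pselect (exists c0, B1 (combination y c0 *~ (lv k)%:Z - f)).
      exists c0 => c Bc; rewrite /A /= combinationB mulrzBl.
      rewrite (_ : _ - _ = (combination y c *~ (lv k)%:Z - f) -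
                           (combination y c0 *~ (lv k)%:Z - f)); first exact: B1B.
      by rewrite opprB addrA subrK.
    by exists 0 => c Bc; case: noc; exists c.
  exists [seq r f | f <- E] => c; have [f fE Bf] := EP (combination y c).
  by exists (r f); [exact: map_f|rewrite mulr1z; exact: rP].
have [q [qn qtb [d d0 qd]]] := folner R covA.
have lw0 : vanishing F (limit_weight F q) by exact: vanishing_limit_weight.
have vw : vanishing F (fun n => d^-1 * limit_weight F q n).
  have [l0 le] := lw0; split=> [n|e e0]; first by rewrite mulr_ge0 ?invr_ge0// ltW.
  apply: filterS (le _ (mulr_gt0 d0 e0)) => n /= ln.
  by rewrite ltr_pdivrMl.
have [b [b1 wb Bb bdvd]] := approximable_dvd k apx vw NB.
(* For lv k = 0 the divisibility forces b = 0, and division by zero gives c = 0. *)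
pose c := \poly_(i < size b) (b`_i %/ (lv k)%:Z)%Z.
have cE i : c`_i = (b`_i %/ (lv k)%:Z)%Z.
  by rewrite coef_poly; case: ltnP => // bi; rewrite nth_default ?div0z.
have bE : b = c *~ (lv k)%:Z.
  by apply/polyP => i; rewrite coefMrz cE mulrzz divzK.
have c1 : c.[1] = 0.
  have : c.[1] * (lv k)%:Z = 0.
    by rewrite -[RHS]b1 bE -mulrzr -(rmorph_int polyC) hornerM hornerC intz.
  move/eqP; rewrite mulf_eq0 => /orP[/eqP//|/eqP lv0].
  suff -> : c = 0 by rewrite horner0.
  by apply/polyP => i; rewrite cE lv0 divz0 coef0.
have qc : q c < d.
  apply: le_lt_trans (pseudonorm_le_weight qn c1 (F := F)) _.
  move: wb; rewrite weightZ ltr_pdivrMl// mulr1; apply: le_lt_trans.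
  apply: ler_weight => i; first by have [l0 _] := lw0; rewrite l0 lexx.
  have [lv0|lv0] := eqVneq (lv k) 0%N; first by rewrite cE lv0 divz0 normr0.
  by rewrite bE coefMrz mulrzz normrM ler_peMr//; lia.
have {}/qd DDc := qc.
rewrite -[x](subrK (combination y b)) addrC; apply: BV => //.
case: DDc => _ [a1 Aa1 [a2 Aa2 <-]] [_ [a3 Aa3 [a4 Aa4 <-]] ca].
rewrite bE combinationMz -ca !combinationB !mulrzBl.
by apply: diffsetP; exact: diffsetP.
Qed.

End GenericTopology.

(** Every n for which there is a level at all gets its level at index n, and the
    remaining indices repeat a level with n <> 1.  As there are only countably many
    n, this makes one sequence of levels cofinal among all neighbourhoods. *)
Theorem precompact_of_complete_below (R : realType) (Z : zmodType) (N : set_system Z) :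
  group_nbhs N -> separated_nbhs N -> complete_below N ->
  forall V, N V -> covered V 1.
Proof.
move=> gN sepN cN V0 NV0; apply: contrapT => ncov.
have [n0 [U0 [NU0 lU0 covn0]]] := level_exists gN NV0.
have n0_neq1 : n0 != 1%N by apply/eqP => n01; apply: ncov; rewrite n01 in covn0.
have /choice[p pP] k : exists p : nat * set Z, [/\ N p.2, level p.1 p.2 &
    (exists2 U, N U & level k U) -> p.1 = k].
  have [[U NU lU]|noU] := pselect (exists2 U, N U & level k U).
    by exists (k, U).
  by exists (n0, U0).
have [F [FF Foo]] := ultraFilterLemma eventually_filter.
have F_oo n : F [set m | (n <= m)%N] by apply: Foo; exists n.
have lvP k : level (p k).1 (p k).2 by have [] := pP k.
have NU k : N (p k).2 by have [] := pP k.
have pE k U : N U -> level k U -> (p k).1 = k.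
  by move=> NUk lU; have [_ _] := pP k; apply; exists U.
have [y yP] := independent_sequence_exists lvP.
have y_dvd := independent_sequence_dvd yP.
have lv_cofinal V : N V -> exists k, covered V (p k).1.
  by move=> /(level_exists gN)[n [U [NUn lU covn]]]; exists n; rewrite (pE n U).
have [x yx] : exists x, converges_to (coarser_nbhs R N F y) (sequence_filter F y) x.
  apply: cN.
  - exact: coarser_group_nbhs.
  - exact: coarser_nbhs_sub.
  - move=> x xW; apply: (approximable0 gN F_oo NU y_dvd lv_cofinal sepN (R := R)).
    exact: intersection_approximable.
  - exact: sequence_filter_cauchy.
apply: (@not_approximable1 R Z N gN F FF F_oo y _ _ NU y_dvd x n0).
  by rewrite (pE n0 U0).
exact: limit_approximable.
Qed.

(** * Compactness *)

(** In a precompact group every ultrafilter is Cauchy. *)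
Lemma precompact_complete_compact (X : topologicalGroupType)
    (X_abelian : commutative (fun x y : X => (x * y)%g)) :
  (forall V, @nbhs_one X X_abelian V -> covered V 1) ->
  complete_below (@nbhs_one X X_abelian) -> separated_nbhs (@nbhs_one X X_abelian) ->
  compact [set: X].
Proof.
move=> covN cN sepN; rewrite compact_ultra => G GU _.
pose A := additive_of X_abelian.
have gN := nbhs_one_group_nbhs X_abelian.
have [|x Gx] := cN _ gN (fun V => id) sepN G (ultra_proper (F := G)).
  move=> V /(group_nbhsB gN)[B NB BV].
  have [E EB] := covN _ NB.
  have [e _ Ge] : exists2 e : A, e \in E & G [set x : A | B (x - e)].
    apply: ultra_finite_union; apply: filterE => x /=.
    by have [e eE Be] := EB x; exists e => //; rewrite mulr1z in Be.
  exists [set x : A | B (x - e)] => // x y Bx By.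
  rewrite -(subrK e x) -addrA -[e - y]opprB; exact: BV.
exists x; split=> // S /(nbhs_translate X_abelian) NS.
apply: filterS (Gx _ NS) => u /=.
have E : (x : A) + ((u : A) - (x : A)) = u by rewrite addrC subrK.
by rewrite -[in X in _ -> X]E.
Qed.

Theorem corollary1p2 (X : topologicalGroupType)
    (X_hausdorff : hausdorff_space X)
    (X_abelian : commutative (fun x y : X => (x * y)%g)) :
  compact [set: X] <->
  (forall (Y : topologicalGroupType) (f : {multiplicative X -> Y}),
     hausdorff_space Y -> injective f -> continuous f ->
     closed (range f)).
Proof.
split=> [cX Y f hY _ cf|clX].
  apply: compact_closed => //; apply: continuous_compact => //.
  exact: continuous_subspaceT.
have cN := closed_images_complete_below (X_abelian := X_abelian) clX.
have sepN := nbhs_one_separated (X_abelian := X_abelian) X_hausdorff.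
apply: (precompact_complete_compact _ cN sepN).
apply: (precompact_of_complete_below Rdefinitions.R) sepN cN.
exact: nbhs_one_group_nbhs.
Qed.
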